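(* The values of $D(n,1)$ for $1\le n\le 8$ are $$D(1,1)=1,\ D(2,1)=2,\ D(3,1)=3,\ D(4,1)=6,\ D(5,1)=10,\ D(6,1)=18,\ D(7,1)=31,\ D(8,1)=58.$$
   Context: Subsets of an $n$-set are identified with their indicator vectors in $\mathbb{F}_2^n$. An asymmetric covering $\mathcal{D}(n,R)$ is a collection of subsets $S$ of an $n$-set such that every subset $T$ of the $n$-set is contained in at least one $S$ in the collection with $|S|-|T|\le R$. $D(n,R)$ denotes the smallest size of any asymmetric covering $\mathcal{D}(n,R)$. Equivalently, $D(n,1)$ is the minimum of $\sum_{u\in\mathbb{F}_2^n}x_u$ over $\{0,1\}$-valued variables $x_u$ subject to $x_v+\sum_{u\supset v,\ \mathrm{dist}(u,v)=1}x_u\ge 1$ for all $v\in\mathbb{F}_2^n$, where $u\supset v$ means the support of $u$ contains the support of $v$ and dist is Hamming distance. *)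

(* Defs.v *)
From mathcomp Require Import all_boot.
Set Implicit Arguments. Unset Strict Implicit. Unset Printing Implicit Defensive.

Definition asym_covering (n R : nat) (C : {set {set 'I_n}}) : Prop :=
  forall T : {set 'I_n}, exists2 S, S \in C & (T \subset S) && (#|S| - #|T| <= R).

Definition is_D (n R d : nat) : Prop :=
  (exists C : {set {set 'I_n}}, asym_covering R C /\ #|C| = d) /\
  (forall C : {set {set 'I_n}}, asym_covering R C -> d <= #|C|).

(* Main.v *)
(** Pass to complements, so that each set S must contain a member missing at most one point of S,
    and let b_k be the number of members of size k. For n = 1, ..., 5 and n = 7 the lower bound
    follows from linear inequalities in the b_k, obtained by averaging local ones over subcubes.

    For n = 6, 8 let s be the number of uncovered points and e the number of uncovered pairs.
    Uncovered pairs form a graph F in which the s uncovered points are independent. A triangle of F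
    must be a member, and the 4-sets force further members, which bounds b_3 + ... + b_6 from below
    on six points by a function of F alone.

    For n = 8 the total is 37 - s - e + b_3 + ... + b_8, so that b_3 + ... + b_8 >= 21 + e + s is
    needed. First, b_4 + ... + b_8 >= 27, where equality makes the members of size 4 a Steiner
    quadruple system and thus b_3 >= 14, with strict inequality if three members of size 3 share
    a pair; in all cases b_3 + ... + b_8 >= 41. Hence only e + s > 20 remains. Averaging the
    six-point bound over the 28 six-sets then settles all graphs, by a linear estimate in e except
    for s = 3, 4, 5 and a few values of e, where the graphs are enumerated. *)
Require Import Defs.
From mathcomp Require Import all_boot zify.

Set Implicit Arguments. Unset Strict Implicit. Unset Printing Implicit Defensive.

(** * Bit vectors, levels and faces of the cube *)

Fixpoint bits n : seq bitseq :=
  if n is n'.+1 then map (cons false) (bits n') ++ map (cons true) (bits n')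
  else [:: [::]].

Definition wt (s : bitseq) := count id s.
Definition lev n k := [seq s <- bits n | wt s == k].
Definition nlev n (x : pred bitseq) k := count x (lev n k).
Arguments nlev : simpl never.
Definition subb (s t : bitseq) := all2 implb s t.

Fixpoint down (s : bitseq) : seq bitseq :=
  if s is b :: s' then (if b then [:: false :: s'] else [::]) ++ map (cons b) (down s')
  else [::].

(* The complements of the blocks of an asymmetric covering with radius 1: every set [s] contains
   one of them that misses at most one point of [s]. *)
Definition cover n (x : pred bitseq) :=
  forall s, size s = n -> x s || has x (down s).

(** [fill V] embeds the cube of dimension [wt V] as the subsets of [V]: the bits of [m] are written
    in order on the support of [V]. *)
Fixpoint fill (V m : bitseq) : bitseq :=
  match V with
  | [::] => [::]
  | true :: V' => head false m :: fill V' (behead m)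
  | false :: V' => false :: fill V' m
  end.

Lemma mem_bits n s : (s \in bits n) = (size s == n).
Proof.
elim: n s => [|n IH] [|b s] //=.
  by rewrite mem_cat; apply/negbTE/norP; split; apply/mapP => [] [].
rewrite mem_cat eqSS -IH.
have inj c : injective (cons c : bitseq -> bitseq) by move=> u v [].
by case: b; rewrite (mem_map (inj _)) ?orbF //; case: mapP => [[? ? []]|//] //=;
  rewrite ?orbF //; case: mapP => [[? ? []]|].
Qed.

Lemma uniq_bits n : uniq (bits n).
Proof.
elim: n => //= n IH; rewrite cat_uniq !map_inj_uniq ?IH //=; try by move=> u v [].
by rewrite andbT; apply/hasPn => s /mapP[u _ ->]; apply/mapP => [] [].
Qed.

Lemma mem_lev n k s : (s \in lev n k) = (size s == n) && (wt s == k).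
Proof. by rewrite mem_filter mem_bits andbC. Qed.

Lemma uniq_lev n k : uniq (lev n k).
Proof. exact/filter_uniq/uniq_bits. Qed.

Lemma wt_le s : wt s <= size s. Proof. exact: count_size. Qed.

Lemma size_fill V m : size (fill V m) = size V.
Proof. by elim: V m => //= [[]] V IH m /=; rewrite IH. Qed.

Lemma wt_fill V m : size m = wt V -> wt (fill V m) = wt m.
Proof.
rewrite /wt; elim: V m => [|[] V IH] [|b m] //= h; rewrite IH //.
by move: h; rewrite add1n => -[].
Qed.

Lemma down_fill V m : size m = wt V -> down (fill V m) = map (fill V) (down m).
Proof.
rewrite /wt; elim: V m => [|[] V IH] [|b m] //= h.
- have {}h : size m = count id V by move: h; rewrite add1n => -[].
  by rewrite IH // map_cat -!map_comp; case: b.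
- by rewrite (IH [::]).
by rewrite IH // -!map_comp.
Qed.

Lemma size_down s t : t \in down s -> size t = size s.
Proof.
elim: s t => //= b s IH t; rewrite mem_cat => /orP[|/mapP[u /IH <- ->]] //=.
by case: b => //; rewrite inE => /eqP ->.
Qed.

(** Whether a set is covered depends only on its subsets, so a covering restricts to the subsets of
    any [V]. *)
Lemma cover_fill n x V : cover n x -> size V = n -> cover (wt V) (x \o fill V).
Proof.
move=> cx sV m sm; have := cx (fill V m); rewrite size_fill => /(_ sV).
by rewrite down_fill // has_map.
Qed.

Lemma downP s t : reflect (exists2 i, nth false s i & t = set_nth false s i false)
                          (t \in down s).
Proof.
apply: (iffP idP); elim: s t => [|b s IH] t //=.
- rewrite mem_cat => /orP[|/mapP[u /IH[i si ->] ->]]; last by exists i.+1.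
  by case: b => //; rewrite inE => /eqP ->; exists 0.
- by case=> i; rewrite nth_nil.
case=> [[|i]] /= h ->; rewrite mem_cat.
  by rewrite h inE eqxx.
by apply/orP; right; apply: map_f; apply: IH; exists i.
Qed.

(** * Double counting *)

Lemma count_sum_mem (T : eqType) (x : pred T) (D L : seq T) :
  uniq D -> {subset L <= D} -> count x L = \sum_(s <- D) count_mem s L * x s.
Proof.
move=> uD; elim: L => [|a L IH] sub /=.
  by rewrite big1_seq.
rewrite IH; last by move=> u uL; apply: sub; rewrite inE uL orbT.
under [RHS]eq_bigr do rewrite mulnDl.
rewrite big_split /=; congr addn.
rewrite (bigD1_seq a) ?sub ?mem_head //= eqxx mul1n big1_seq ?addn0 // => s /andP[ne _].
by rewrite eq_sym (negbTE ne).
Qed.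

Lemma count_lev n k x : nlev n x k = \sum_(s <- bits n) (wt s == k) * x s.
Proof.
rewrite /nlev /lev count_filter; elim: (bits n) => [|a l IH] /=; rewrite ?big_nil // big_cons IH.
by case: (wt a == k); case: (x a).
Qed.

(** Every [s] occurs [w (wt s)] times in [L]. Deciding this by computation replaces the binomial
    counts in each averaging argument. *)
Definition lcheck n (w : nat -> nat) (L : seq bitseq) :=
  all (fun s => size s == n) L && all (fun s => count_mem s L == w (wt s)) (bits n).

Lemma count_levels n w L x : lcheck n w L ->
  count x L = \sum_(k < n.+1) w k * nlev n x k.
Proof.
case/andP=> /allP sL /allP wL.
rewrite (@count_sum_mem _ x (bits n)) ?uniq_bits //; last first.
  by move=> s /sL; rewrite mem_bits.
under [RHS]eq_bigr do rewrite count_lev big_distrr /=.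
rewrite exchange_big /=; apply: eq_big_seq => s sb.
have := sb; rewrite mem_bits => /eqP sn.
have wn : wt s < n.+1 by rewrite ltnS -sn wt_le.
rewrite (bigD1 (Ordinal wn)) //= eqxx mul1n big1 ?addn0; first by rewrite (eqP (wL s sb)).
move=> i ne; rewrite (_ : wt s == i = false) ?muln0 //; apply/negbTE.
by apply: contra ne => /eqP e; apply/eqP/val_inj.
Qed.

Lemma sum_count (I : eqType) (T : Type) (r : seq I) (loc : I -> seq T) x :
  \sum_(i <- r) count x (loc i) = count x (flatten (map loc r)).
Proof. by rewrite count_flatten -map_comp sumnE big_map. Qed.

Lemma dcount n w (I : eqType) (r : seq I) (loc : I -> seq bitseq) (c : I -> nat) x :
  lcheck n w (flatten (map loc r)) -> (forall i, i \in r -> c i <= count x (loc i)) ->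
  \sum_(i <- r) c i <= \sum_(k < n.+1) w k * nlev n x k.
Proof.
move=> /(count_levels x) <- h; rewrite -sum_count big_seq [leqRHS]big_seq.
exact: leq_sum.
Qed.

Lemma sum_const_seq (I : eqType) (r : seq I) c : \sum_(i <- r) c = size r * c.
Proof. by rewrite big_const_seq count_predT iter_addn_0 mulnC. Qed.

(** Serves the extremal cases: when an averaged inequality is tight, so is each local one. *)
Lemma sum_leq_eq (I : eqType) (r : seq I) (f g : I -> nat) :
  (forall i, i \in r -> f i <= g i) -> \sum_(i <- r) g i <= \sum_(i <- r) f i ->
  forall i, i \in r -> g i = f i.
Proof.
move=> fg h i ir; apply/eqP; rewrite eqn_leq fg // andbT leqNgt; apply/negP => lt.
move: h; apply/negP; rewrite -ltnNge.
elim: r fg ir => // a r IH fg; rewrite inE !big_cons.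
have fa : f a <= g a by apply: fg; rewrite mem_head.
have fr : \sum_(j <- r) f j <= \sum_(j <- r) g j.
  rewrite big_seq [leqRHS]big_seq; apply: leq_sum => j jr.
  by apply: fg; rewrite inE jr orbT.
case/orP=> [/eqP e|ir]; first by move: lt; rewrite e => lt; lia.
have fr' j : j \in r -> f j <= g j by move=> jr; apply: fg; rewrite inE jr orbT.
by have := IH fr' ir; lia.
Qed.

Lemma count_bits n x : count x (bits n) = \sum_(k < n.+1) nlev n x k.
Proof.
rewrite (@count_levels n (fun=> 1)); first by apply: eq_bigr => k _; rewrite mul1n.
apply/andP; split; first by apply/allP => s; rewrite mem_bits.
by apply/allP => s sb; rewrite count_uniq_mem ?uniq_bits // sb.
Qed.

(** * Coverings as predicates on bit vectors *)

Definition set_of n (s : bitseq) : {set 'I_n} := [set i : 'I_n | nth false s i].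

Lemma set_of_inj n s t : size s = n -> size t = n -> set_of n s = set_of n t -> s = t.
Proof.
move=> ss st e; apply: (@eq_from_nth _ false); rewrite ?ss ?st // => i ltin.
by have := congr1 (fun A : {set 'I_n} => Ordinal ltin \in A) e; rewrite /= !inE.
Qed.

Lemma set_of_surj n (A : {set 'I_n}) : exists2 s, size s = n & set_of n s = A.
Proof.
exists [seq i \in A | i <- enum 'I_n]; first by rewrite size_map size_enum_ord.
apply/setP => i; rewrite inE (nth_map i) ?size_enum_ord // nth_ord_enum //.
Qed.

Lemma set_of_upd n s (i : 'I_n) : set_of n (set_nth false s i false) = set_of n s :\ i.
Proof. by apply/setP => j; rewrite !inE nth_set_nth /= -val_eqE; case: eqP. Qed.

Lemma lower_bridge n d (C : {set {set 'I_n}}) :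
  (forall x, cover n x -> d <= count x (bits n)) -> asym_covering 1 C -> d <= #|C|.
Proof.
move=> low cC; pose x (s : bitseq) := ~: set_of n s \in C.
have cx : cover n x.
  move=> s ss; have [S SC /andP[sub card]] := cC (~: set_of n s).
  have [e|ne] := eqVneq S (~: set_of n s); first by rewrite /x -e SC.
  have /set0Pn[i] : S :\: ~: set_of n s != set0.
    by rewrite setD_eq0; apply: contra ne => sub'; rewrite eqEsubset sub' sub.
  rewrite !inE negbK => /andP[si iS].
  suff e : S = ~: (set_of n s :\ i).
    apply/orP; right; apply/hasP; exists (set_nth false s i false); first by apply/downP; exists i.
    by rewrite /x set_of_upd -e.
  apply/esym/eqP; rewrite eqEcard; apply/andP; split.
    by rewrite setCD subUset sub sub1set iS.
  have cs : #|set_of n s| = #|set_of n s :\ i|.+1 by rewrite (cardsD1 i) inE si.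
  move: card; rewrite !leq_subLR => card.
  have := cardsC (set_of n s); have := cardsC (set_of n s :\ i).
  by rewrite cs; move: card; set a := #|S|; set b := #|~: set_of n s|;
     set c := #|set_of n s :\ i|; set d' := #|~: (_ :\ _)|; lia.
apply: leq_trans (low x cx) _; rewrite -size_filter -(size_map (fun s => ~: set_of n s)).
rewrite -(card_uniqP _); last rewrite map_inj_in_uniq ?filter_uniq ?uniq_bits // => s t.
  by apply/subset_leq_card/subsetP => A /mapP[s]; rewrite mem_filter => /andP[xs _] ->.
rewrite !mem_filter !mem_bits => /andP[_ /eqP ss] /andP[_ /eqP st] /setC_inj.
exact: set_of_inj.
Qed.

Definition is_code n (l : seq bitseq) :=
  [&& uniq l, all (fun s => size s == n) l & all (fun s => (s \in l) || has [in l] (down s)) (bits n)].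

Lemma upper_bridge n l : is_code n l ->
  exists C : {set {set 'I_n}}, asym_covering 1 C /\ #|C| = size l.
Proof.
case/and3P=> ul /allP sl /allP cl.
pose f s := ~: set_of n s.
exists [set A in map f l]; split; last first.
  rewrite cardsE (card_uniqP _) ?size_map // map_inj_in_uniq // => s t sin tin /setC_inj.
  by apply: set_of_inj; apply/eqP/sl.
move=> T; have [s ss eT] := set_of_surj (~: T).
have {}eT : T = f s by rewrite /f eT setCK.
have := cl s; rewrite mem_bits ss eqxx => /(_ isT) /orP[sin|/hasP[t /downP[i si ->] tin]].
  by exists T; rewrite ?subxx ?subnn // inE eT map_f.
have lti : i < n by rewrite -ss ltnNge; apply: contraL si => le; rewrite nth_default.
exists (f (set_nth false s i false)); first by rewrite inE map_f.
rewrite /f (set_of_upd s (Ordinal lti)) eT /f setCD.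
by rewrite subsetUl leq_subLR cardsU cards1 addnC leq_subr.
Qed.

(** * Permuting coordinates *)

Definition pm (p : seq nat) (m : bitseq) : bitseq := [seq nth false m i | i <- p].

Lemma pm_inj n p : perm_eq p (iota 0 n) ->
  {in [pred m | size m == n] &, injective (pm p)}.
Proof.
move=> pp m1 m2 /eqP s1 /eqP s2 /eq_in_map e; apply: (@eq_from_nth _ false).
  by rewrite s1 s2.
by move=> i; rewrite s1 => lti; apply: e; rewrite (perm_mem pp) mem_iota.
Qed.

Lemma size_pm n p m : perm_eq p (iota 0 n) -> size (pm p m) = n.
Proof. by move=> /perm_size; rewrite size_map size_iota. Qed.

Lemma wt_pm n p m : perm_eq p (iota 0 n) -> size m = n -> wt (pm p m) = wt m.
Proof.
move=> /(perm_map (nth false m)) /permP /(_ id) e sm; rewrite /wt /pm e -sm.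
by rewrite -/(mkseq _ _) mkseq_nth.
Qed.

Lemma count_pm n p x k : perm_eq p (iota 0 n) ->
  nlev n (x \o pm p) k = nlev n x k.
Proof.
move=> pp; rewrite /nlev -count_map; apply/permP.
have u : uniq (map (pm p) (lev n k)).
  rewrite map_inj_in_uniq ?uniq_lev // => m1 m2; rewrite !mem_lev => /andP[s1 _] /andP[s2 _].
  exact: (pm_inj pp).
apply: uniq_perm; rewrite ?uniq_lev //.
have [] // := uniq_min_size u (s2 := lev n k); last by rewrite size_map.
move=> s /mapP[m]; rewrite mem_lev => /andP[/eqP sm wm] ->.
by rewrite mem_lev (size_pm _ pp) (wt_pm pp) // eqxx.
Qed.

Lemma cover_pm n p x : perm_eq p (iota 0 n) -> cover n x -> cover n (x \o pm p).
Proof.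
move=> pp cx m sm; have up : uniq p by rewrite (perm_uniq pp) iota_uniq.
have sp : size p = n by rewrite (perm_size pp) size_iota.
case/orP: (cx (pm p m) (size_pm _ pp)) => [xm|/hasP[t /downP[j pj ->] xt]].
  by rewrite /= xm.
have ltj : j < size p by rewrite ltnNge; apply: contraL pj => le; rewrite nth_default ?size_map.
apply/orP; right; apply/hasP; exists (set_nth false m (nth 0 p j) false).
  by apply/downP; exists (nth 0 p j); rewrite // -(nth_map 0 false (nth false m)).
rewrite /= (_ : pm p _ = set_nth false (pm p m) j false) //.
apply: (@eq_from_nth _ false) => [|i]; rewrite /pm.
  by rewrite size_set_nth !size_map; apply/esym/maxn_idPr.
rewrite size_map => lti; rewrite nth_set_nth /= !(nth_map 0) // nth_set_nth /=.
by rewrite nth_uniq.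
Qed.

Definition inv_perm n (o : seq nat) := [seq index j o | j <- iota 0 n].

Lemma inv_permK n o m : perm_eq o (iota 0 n) -> size m = n -> pm (inv_perm n o) (pm o m) = m.
Proof.
move=> po sm; apply: (@eq_from_nth _ false); first by rewrite !size_map size_iota.
rewrite !size_map size_iota => i lti.
have io : i \in o by rewrite (perm_mem po) mem_iota.
rewrite (nth_map 0) ?size_map ?size_iota //.
have -> : nth 0 (inv_perm n o) i = index i o by rewrite (nth_map 0) ?size_iota // nth_iota.
by rewrite (nth_map 0) ?index_mem // nth_index.
Qed.

Lemma perm_inv_perm n o : perm_eq o (iota 0 n) -> perm_eq (inv_perm n o) (iota 0 n).
Proof.
move=> po; have so : size o = n by rewrite (perm_size po) size_iota.
have io i : (i \in o) = (i < n) by rewrite (perm_mem po) mem_iota.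
have u : uniq (inv_perm n o).
  rewrite map_inj_in_uniq ?iota_uniq // => i j; rewrite !mem_iota -!io => io' jo.
  by move=> e; rewrite -(nth_index 0 io') e nth_index.
apply: uniq_perm; rewrite ?iota_uniq //.
have [] // := uniq_min_size u (s2 := iota 0 n); last by rewrite size_map.
by move=> i /mapP[j]; rewrite mem_iota => ltj ->; rewrite mem_iota /= add0n -[X in _ < X]so index_mem io.
Qed.

(** * Linear inequalities between the levels; the cases n = 1, ..., 5 and 7 *)

Lemma cov_dc n w k x : cover n x -> lcheck n w (flatten [seq s :: down s | s <- lev n k]) ->
  size (lev n k) <= \sum_(j < n.+1) w j * nlev n x j.
Proof.
move=> cx lc; rewrite -[size _]muln1 -sum_const_seq.
apply: (dcount lc) => s; rewrite mem_lev => /andP[/eqP ss _] /=.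
by have := cx s ss; rewrite has_count; case: (x s) => //=; lia.
Qed.

Lemma face_dc n m w L (c : bitseq -> nat) x :
  lcheck n w (flatten [seq map (fill V) L | V <- lev n m]) ->
  (forall V, size V = n -> wt V = m -> c V <= count (x \o fill V) L) ->
  \sum_(V <- lev n m) c V <= \sum_(j < n.+1) w j * nlev n x j.
Proof.
move=> lc h; apply: (dcount lc) => V; rewrite mem_lev => /andP[/eqP sV /eqP wV].
by rewrite count_map; apply: h.
Qed.

Lemma face_cover n m x V : cover n x -> size V = n -> wt V = m -> cover m (x \o fill V).
Proof. by move=> cx sV <-; apply: cover_fill sV. Qed.

Ltac expand H := move: H; rewrite ?big_ord_recr ?big_ord0 /= => H.

Definition dbound n d := forall x, cover n x -> d <= count x (bits n).

(** The empty set has nothing below it, so it must be a member. *)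
Lemma lev0 n x : cover n x -> nlev n x 0 = 1.
Proof.
rewrite /nlev => cx; suff -> : lev n 0 = [:: nseq n false].
  have := cx (nseq n false); rewrite size_nseq => /(_ erefl).
  suff -> : down (nseq n false) = [::] by rewrite /= orbF => ->.
  by elim: n {cx} => //= n ->.
rewrite /lev; elim: n {cx} => //= n IH; rewrite filter_cat !filter_map.
rewrite (eq_filter (a2 := fun s => wt s == 0)); last by move=> s; rewrite /wt /= add0n.
rewrite IH (eq_filter (a2 := pred0)) ?filter_pred0 //.
Qed.

Ltac total n x := rewrite (count_bits n x); rewrite ?big_ord_recr ?big_ord0 /=.

(** The weights are [n - k + 1] at level [k - 1], the number of [k]-sets above a given set, and 1 at
    level [k]. *)
Ltac cov H n w k x cx :=
  assert (H : lcheck n (nth 0 w) (flatten [seq s :: down s | s <- lev n k]))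
    by (vm_cast_no_check (erefl true));
  apply (@cov_dc n (nth 0 w) k x cx) in H;
  let c := eval vm_compute in (size (lev n k)) in change (size (lev n k)) with c in H.

Lemma lift_dc n m w L d x :
  (forall y, cover m y -> d <= count y L) -> cover n x ->
  lcheck n w (flatten [seq map (fill V) L | V <- lev n m]) ->
  size (lev n m) * d <= \sum_(j < n.+1) w j * nlev n x j.
Proof.
move=> h cx lc; rewrite -sum_const_seq; apply: (face_dc lc) => V sV wV.
exact/h/(face_cover cx).
Qed.

(** At the levels occurring in [L], entry [j] of [w] is the binomial coefficient of [n - j] over
    [m - j], the number of [m]-faces containing a given [j]-set. *)
Ltac lift H n m w L h cx :=
  assert (H : lcheck n (nth 0 w) (flatten [seq map (fill V) L | V <- lev n m]))
    by (vm_cast_no_check (erefl true));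
  apply (@lift_dc n m (nth 0 w) L _ _ h cx) in H;
  let c := eval vm_compute in (size (lev n m)) in change (size (lev n m)) with c in H.

Lemma dbound1 : dbound 1 1.
Proof. by move=> x cx; total 1 x; rewrite lev0 //; lia. Qed.

Lemma dbound2 : dbound 2 2.
Proof.
move=> x cx; total 2 x; cov H2 2 [:: 0; 1; 1] 2 x cx; expand H2.
have := lev0 cx; lia.
Qed.

Lemma dbound3 : dbound 3 3.
Proof.
move=> x cx; total 3 x; cov H2 3 [:: 0; 0; 1; 1] 3 x cx; expand H2.
lift H3 3 2 [:: 3; 2; 1] (bits 2) dbound2 cx; expand H3.
have := lev0 cx; lia.
Qed.

(** From [2 * b_1 + b_2 >= 3] by halving and rounding up; this rounding is the gain when averaging
    over the faces of the 4-cube. *)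
Lemma local3 y : cover 3 y -> 2 <= count y (lev 3 1 ++ lev 3 2).
Proof.
move=> cy; rewrite count_cat; change (2 <= nlev 3 y 1 + nlev 3 y 2).
cov G2 3 [:: 0; 2; 1] 2 y cy; expand G2.
cov G3 3 [:: 0; 0; 1; 1] 3 y cy; expand G3.
lia.
Qed.

Lemma dbound4 : dbound 4 6.
Proof.
move=> x cx; total 4 x.
cov H4 4 [:: 0; 0; 0; 1; 1] 4 x cx; expand H4.
cov H3 4 [:: 0; 0; 2; 1] 3 x cx; expand H3.
lift L3 4 3 [:: 0; 3; 2] (lev 3 1 ++ lev 3 2) local3 cx; expand L3.
have := lev0 cx; lia.
Qed.

Lemma dbound5 : dbound 5 10.
Proof.
move=> x cx; total 5 x.
cov H5 5 [:: 0; 0; 0; 0; 1; 1] 5 x cx; expand H5.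
cov H4 5 [:: 0; 0; 0; 2; 1] 4 x cx; expand H4.
cov H3 5 [:: 0; 0; 3; 1] 3 x cx; expand H3.
lift L4 5 4 [:: 5; 4; 3; 2; 1] (bits 4) dbound4 cx; expand L4.
have := lev0 cx; lia.
Qed.

Lemma local5 y : cover 5 y -> 3 <= count y (lev 5 3 ++ lev 5 4).
Proof.
move=> cy; rewrite count_cat; change (3 <= nlev 5 y 3 + nlev 5 y 4).
cov G4 5 [:: 0; 0; 0; 2; 1] 4 y cy; expand G4.
cov G5 5 [:: 0; 0; 0; 0; 1; 1] 5 y cy; expand G5.
lia.
Qed.

Lemma dbound7 : dbound 6 18 -> dbound 7 31.
Proof.
move=> d6 x cx; total 7 x.
cov H3 7 [:: 0; 0; 5; 1] 3 x cx; expand H3.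
cov H5 7 [:: 0; 0; 0; 0; 3; 1] 5 x cx; expand H5.
cov H6 7 [:: 0; 0; 0; 0; 0; 2; 1] 6 x cx; expand H6.
cov H7 7 [:: 0; 0; 0; 0; 0; 0; 1; 1] 7 x cx; expand H7.
lift L6 7 6 [:: 7; 6; 5; 4; 3; 2; 1] (bits 6) d6 cx; expand L6.
lift L5 7 5 [:: 0; 0; 0; 6; 3] (lev 5 3 ++ lev 5 4) local5 cx; expand L5.
have := lev0 cx; lia.
Qed.

Opaque lev.

(** * Six points *)

Lemma down_sub s p : p \in down s -> subb p s /\ wt s = (wt p).+1.
Proof.
elim: s p => //= b s IH p; rewrite mem_cat => /orP[|/mapP[u /IH[us wu] ->]] /=.
  case: b => //; rewrite inE => /eqP ->; split => //=.
  by rewrite /subb; elim: s {IH} => //= b s ->; rewrite implybb.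
by rewrite implybb us /wt /= -/(wt s) wu /wt addnS.
Qed.

Definition sublev n k s := [seq p <- lev n k | subb p s].
Definition suplev n k s := [seq p <- lev n k | subb s p].

Arguments sublev : simpl never.
Arguments suplev : simpl never.

Lemma down_sublev n k s p : size s = n -> wt s = k.+1 -> p \in down s -> p \in sublev n k s.
Proof.
move=> ss ws pd; have [sub w] := down_sub pd.
by rewrite mem_filter sub mem_lev (size_down pd) ss eqxx -eqSS -w ws eqxx.
Qed.

Lemma cover_sublev n k x s : cover n x -> size s = n -> wt s = k.+1 ->
  x s || has x (sublev n k s).
Proof.
move=> cx ss ws; case/orP: (cx s ss) => [-> //|/hasP[p pd xp]].
by apply/orP; right; apply/hasP; exists p => //; apply: down_sublev pd.
Qed.

Definition uncov n (x : pred bitseq) : pred bitseq := fun R => all (predC x) (sublev n 2 R).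
(** The graph of uncovered pairs as an edge vector in the order of [lev n 2]. Its triangles are the
    triples satisfying [uncov]. *)
Definition fbits n (x : pred bitseq) := [seq ~~ x p | p <- lev n 2].

Definition tri_masks := [seq [seq subb p R | p <- lev 6 2] | R <- lev 6 3].
Definition quad_masks := [seq [seq subb R K | R <- lev 6 3] | K <- lev 6 4].
Definition star_masks := [seq [seq subb p R | R <- lev 6 3] | p <- lev 6 2].
Definition tribits F := [seq all id (mask m F) | m <- tri_masks].

(* Here [t] counts the triangles of the graph [F] on six points and [c] the 4-sets containing one.
   The first branch applies if three triangles share an edge and cover all these 4-sets. *)
Definition bound6 F :=
  let tau := tribits F in
  let t := count id tau in
  let c := count (fun m => has id (mask m tau)) quad_masks in
  if (c == 6) && has (fun m => 2 < count id (mask m tau)) star_masks then t + 7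
  else t + 4 + (14 - c) %/ 3.

Lemma mask_map (T : Type) (a f : T -> bool) s : mask (map a s) (map f s) = map f (filter a s).
Proof. by rewrite -map_mask -filter_mask. Qed.

Lemma tribitsE y : tribits (fbits 6 y) = map (uncov 6 y) (lev 6 3).
Proof.
rewrite /tribits /tri_masks -map_comp; apply: eq_map => R /=.
by rewrite /fbits mask_map all_map /uncov; apply: eq_all.
Qed.

Lemma local6 y : cover 6 y -> 4 <= nlev 6 y 4 + nlev 6 y 5 + nlev 6 y 6.
Proof.
move=> cy; cov G5 6 [:: 0; 0; 0; 0; 2; 1] 5 y cy; expand G5.
cov G6 6 [:: 0; 0; 0; 0; 0; 1; 1] 6 y cy; expand G6.
lia.
Qed.

Definition newquad A R : pred bitseq :=
  fun K => if subb R K then ~~ has (fun S => subb S K) A else false.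
Definition newquads A R := count (newquad A R) (lev 6 4).

(** Applied to at least three triples [A] through one pair. These account for all 4-sets containing
    the pair, so the triples in [r] avoid it and lie in the complementary 4-set. Any two of them
    share that 4-set and add at most 5 new ones. *)
Definition star_ok A :=
  let r := [seq R <- lev 6 3 | 2 < newquads A R] in
  all (fun R1 => all (fun R2 => count (predU (newquad A R1) (newquad A R2)) (lev 6 4) <= 5) r) r.

Lemma star_check : all (fun p => all (fun m => star_ok (mask m (suplev 6 3 p)))
    [seq m <- bits 4 | 2 < count id m]) (lev 6 2).
Proof. by vm_cast_no_check (erefl true). Qed.

Lemma newquads_le A R : R \in lev 6 3 -> newquads A R <= 3.
Proof.
move=> RL; have /allP/(_ R RL)/eqP <- : all (fun R => size (suplev 6 4 R) == 3) (lev 6 3).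
  by vm_cast_no_check (erefl true).
by rewrite size_filter; apply: sub_count => K; rewrite /newquad /=; case: ifP.
Qed.

Lemma count_sum (I : Type) (a : pred I) r : count a r = \sum_(i <- r) a i.
Proof. by elim: r => [|i r IH]; rewrite ?big_nil // big_cons -IH. Qed.

Section Six.
Variable y : pred bitseq.
Hypothesis cy : cover 6 y.

Let T := uncov 6 y.
Let extra := [pred R | y R && ~~ T R].
Let U := nlev 6 y 4 + nlev 6 y 5 + nlev 6 y 6.
Let q := count (fun K => ~~ has y (sublev 6 3 K)) (lev 6 4).
Let c := count (fun K => has T (sublev 6 3 K)) (lev 6 4).

Lemma uncov_in R : R \in lev 6 3 -> T R -> y R.
Proof.
rewrite mem_lev => /andP[/eqP sR /eqP wR] TR.
case/orP: (cover_sublev cy sR wR) => // /hasP[p pd yp].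
by have /allP/(_ p pd) := TR; rewrite /= yp.
Qed.

Lemma six_split : nlev 6 y 3 = nlev 6 T 3 + nlev 6 extra 3.
Proof.
rewrite /nlev -count_predUI (_ : count (predI T extra) _ = 0) ?addn0; last first.
  apply/eqP; rewrite -leqn0 leqNgt -has_count; apply/hasPn => R _ /=.
  by case: (T R); rewrite ?andbF.
apply: eq_in_count => R RL /=; have := uncov_in RL.
by case: (T R) => [-> //|_] /=; rewrite andbT.
Qed.

(** A 4-set without member triples must be a member, and the full 6-set forces one more member of
    size 5 or 6. *)
Lemma six_U : q < U.
Proof.
cov G6 6 [:: 0; 0; 0; 0; 0; 1; 1] 6 y cy; expand G6.
have : q <= nlev 6 y 4; last by rewrite /U; lia.
rewrite /q /nlev -!size_filter; apply: uniq_leq_size; first exact/filter_uniq/uniq_lev.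
move=> K; rewrite mem_filter => /andP[nh KL]; rewrite mem_filter KL andbT.
move: KL; rewrite mem_lev => /andP[/eqP sK /eqP wK].
by case/orP: (cover_sublev cy sK wK) => // h; rewrite h in nh.
Qed.

(** Each of the fifteen 4-sets is counted by [q] or by [c] or contains an extra triple, and a triple
    lies in three 4-sets. *)
Lemma six_quads : 15 <= q + c + 3 * nlev 6 extra 3.
Proof.
have lc : lcheck 6 (nth 0 [:: 0; 0; 0; 3]) (flatten [seq sublev 6 3 K | K <- lev 6 4]).
  by vm_cast_no_check (erefl true).
have := count_levels extra lc; rewrite -sum_count => e; expand e.
have -> : 3 * nlev 6 extra 3 = \sum_(K <- lev 6 4) count extra (sublev 6 3 K) by rewrite e; lia.
rewrite /q /c !count_sum -!big_split.
have -> : 15 = \sum_(K <- lev 6 4) 1 by rewrite sum_const_seq muln1; vm_compute.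
apply: leq_sum => K _; have [hy|//] := boolP (has y (sublev 6 3 K)).
have [//|nT] := boolP (has T (sublev 6 3 K)).
suff : has extra (sublev 6 3 K) by rewrite has_count.
case/hasP: hy => R RK yR; apply/hasP; exists R; first exact: RK.
apply/andP; split; first exact: yR.
by apply: contra nT => TR; apply/hasP; exists R.
Qed.

Lemma six_bound : bound6 (fbits 6 y) <= nlev 6 y 3 + U.
Proof.
have qU := six_U; have qc := six_quads; have U4 : 4 <= U by exact: local6.
rewrite /bound6 tribitsE six_split.
have -> : count id (map T (lev 6 3)) = nlev 6 T 3 by rewrite count_map.
have -> : count (fun m => has id (mask m (map T (lev 6 3)))) quad_masks = c.
  by rewrite count_map; apply: eq_count => K /=; rewrite mask_map has_map.
case: ifP => [/andP[/eqP c6 /hasP[m0 /mapP[p pL ->] h]]|_]; last first.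
  (* With [m] extra triples, [m + U] is at least [m + 4] and at least [16 - c - 2 * m]. In either
     range of [m] this gives 4 plus the ceiling of [(12 - c) / 3], and [(14 - c) %/ 3] is that
     ceiling, or 0 if it is negative. *)
  by have := leq_trunc_div (14 - c) 3; move: (nlev 6 T 3) (nlev 6 extra 3) qc U4 qU => t m; lia.
(* For [c = 6], fewer than two extra triples leave [q >= 6], and three or more already give 7. With
   exactly two, the star must provide [q >= 4]. *)
have [m2|m2] := eqVneq (nlev 6 extra 3) 2; last by move: qc; rewrite c6; lia.
suff : 4 <= q by rewrite m2; lia.
have : size [seq R <- lev 6 3 | extra R] = 2 by rewrite size_filter.
case E : [seq R <- lev 6 3 | extra R] => [|R1 [|R2 []]] // _.
have in_E R : (R \in [:: R1; R2]) = extra R && (R \in lev 6 3) by rewrite -E mem_filter.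
have /andP[_ R1L] : extra R1 && (R1 \in lev 6 3) by rewrite -in_E mem_head.
have /andP[_ R2L] : extra R2 && (R2 \in lev 6 3) by rewrite -in_E !inE eqxx orbT.
pose A := [seq R <- suplev 6 3 p | T R].
have okA : star_ok A.
  have /allP/(_ p pL)/allP/(_ (map T (suplev 6 3 p))) := star_check.
  rewrite /A (filter_mask T (suplev 6 3 p)); apply.
  rewrite mem_filter mem_bits size_map; apply/andP; split; first by move: h; rewrite mask_map.
  have /allP/(_ p pL) // : all (fun p => size (suplev 6 3 p) == 4) (lev 6 2).
  by vm_cast_no_check (erefl true).
have new5 : count (predU (newquad A R1) (newquad A R2)) (lev 6 4) <= 5.
  have n1 := newquads_le A R1L; have n2 := newquads_le A R2L.
  have le12 : count (predU (newquad A R1) (newquad A R2)) (lev 6 4) <=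
      newquads A R1 + newquads A R2 by rewrite -count_predUI leq_addr.
  have [h1|h1] := ltnP 2 (newquads A R1); last by lia.
  have [h2|h2] := ltnP 2 (newquads A R2); last by lia.
  move/allP: okA => /(_ R1); rewrite mem_filter h1 R1L => /(_ isT) /allP /(_ R2).
  by rewrite mem_filter h2 R2L; apply.
suff : 15 <= q + c + count (predU (newquad A R1) (newquad A R2)) (lev 6 4) by rewrite c6; lia.
rewrite /q /c !count_sum -!big_split.
have -> : 15 = \sum_(K <- lev 6 4) 1 by rewrite sum_const_seq muln1; vm_compute.
apply: leq_sum => K _; have [hy|//] := boolP (has y (sublev 6 3 K)).
have [//|nT] := boolP (has T (sublev 6 3 K)).
suff : predU (newquad A R1) (newquad A R2) K by move=> ->.
case/hasP: hy => R; rewrite mem_filter => /andP[RK RL] yR.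
have nA : ~~ has (fun S => subb S K) A.
  apply: contra nT => /hasP[S]; rewrite mem_filter => /andP[TS].
  rewrite mem_filter => /andP[_ SL] SK.
  by apply/hasP; exists S; [rewrite mem_filter SK SL | exact: TS].
have eR : extra R.
  apply/andP; split; first exact: yR.
  by apply: contra nT => TR; apply/hasP; exists R; [rewrite mem_filter RK RL | exact: TR].
have : R \in [:: R1; R2] by rewrite in_E eR.
by rewrite !inE /newquad => /orP[] /eqP <-; rewrite RK nA ?orbT.
Qed.

End Six.

Arguments six_bound : clear implicits.

(** Binary tries indexed by bit vectors. They tabulate functions for large case checks and later
    hold partial assignments. *)
Inductive tree := Leaf of nat | Node of tree & tree.

Fixpoint build n (f : bitseq -> nat) :=
  if n is n'.+1 then Node (build n' (f \o cons false)) (build n' (f \o cons true))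
  else Leaf (f [::]).

Fixpoint query t (s : bitseq) :=
  match t, s with
  | Leaf a, _ => a
  | Node l r, b :: s' => query (if b then r else l) s'
  | Node _ _, [::] => 0
  end.

Lemma query_build n f s : size s = n -> query (build n f) s = f s.
Proof. by elim: n f s => [|n IH] f [|[] s] //= [ss]; rewrite IH. Qed.

(** Affine bounds on the edge number, valid for all graphs on six points. Summed over the 6-sets
    they bound the edges of a graph on eight points. *)
Definition graph_ok F := let w := bound6 F in let e := wt F in
  [&& 8 <= w, e <= w.+1 & 3 * e <= 2 * w + 12].

Lemma graph_check : all graph_ok (bits 15).
Proof. by vm_cast_no_check (erefl true). Qed.

(** * Uncovered points, and the bound for six points *)

Lemma subb_nth s t i : subb s t -> nth false s i -> nth false t i.
Proof.
elim: s t i => [|a s IH] [|b t] [|i] //= /andP[ab st]; last exact: IH.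
by move: ab; case: a.
Qed.

Lemma subb_trans s t u : subb s t -> subb t u -> subb s u.
Proof.
elim: s t u => [|a s IH] [|b t] [|c u] //= /andP[ab st] /andP[bc tu].
by apply/andP; split; [move: ab bc; case: a b => [] [] | exact: IH st tu].
Qed.

Definition unit n i := mkseq (eqn i) n.
Definition free n (x : pred bitseq) := mkseq (fun i => ~~ x (unit n i)) n.

Lemma size_free n x : size (free n x) = n. Proof. exact: size_mkseq. Qed.

Definition units_ok n := perm_eq (lev n 1) [seq unit n i | i <- iota 0 n].

Lemma wt_free n x : units_ok n -> wt (free n x) + nlev n x 1 = n.
Proof.
move=> /permP/(_ x) e; rewrite /nlev e /wt /free /mkseq !count_map addnC.
by rewrite -[RHS](size_iota 0 n) -(count_predC [pred i | x (unit n i)]).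
Qed.

(** A pair that is not a member contains a member point, whereas the points of [p] are uncovered. *)
Lemma free_pair n x p : units_ok n -> cover n x -> p \in lev n 2 -> subb p (free n x) -> x p.
Proof.
move=> uo cx; rewrite mem_lev => /andP[/eqP sp /eqP wp] pS.
case/orP: (cx p sp) => // /hasP[u ud xu].
have [us wu] := down_sub ud.
have : u \in lev n 1 by rewrite mem_lev (size_down ud) sp eqxx -eqSS -wu wp.
rewrite (perm_mem uo) => /mapP[i]; rewrite mem_iota => /= ltin eu.
have : nth false (free n x) i.
  by apply: subb_nth (subb_trans us pS) _; rewrite eu nth_mkseq //; apply/eqP.
by rewrite nth_mkseq // -eu xu.
Qed.

Lemma wt_fbits n x : wt (fbits n x) + nlev n x 2 = size (lev n 2).
Proof. by rewrite /wt /fbits count_map addnC /nlev -(count_predC x (lev n 2)). Qed.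

Lemma free_edges n x : units_ok n -> cover n x ->
  forall p, p \in lev n 2 -> (~~ x p <= ~~ subb p (free n x))%N.
Proof.
by move=> uo cx p pl; case: (boolP (subb p _)) => [/(free_pair uo cx pl) ->|_]; case: (x p).
Qed.

Lemma wt_fbits_le n x : units_ok n -> cover n x ->
  wt (fbits n x) <= count (fun p => ~~ subb p (free n x)) (lev n 2).
Proof.
move=> uo cx; rewrite /wt /fbits count_map !count_sum big_seq [leqRHS]big_seq.
exact: leq_sum (free_edges uo cx).
Qed.

Lemma dbound6 : dbound 6 18.
Proof.
move=> x cx; total 6 x; have b0 := lev0 cx.
have uo : units_ok 6 by vm_cast_no_check (erefl true).
have ws := wt_free x uo; have we := wt_fbits 6 x.
have e15 : size (lev 6 2) = 15 by vm_compute.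
rewrite {}e15 in we; have wle := wt_fbits_le uo cx.
have bound := six_bound _ cx.
have : graph_ok (fbits 6 x).
  by apply: (allP graph_check); rewrite mem_bits size_map; vm_compute.
case/and3P => w8 we1 _.
(* With [s] uncovered points and [e] uncovered pairs the total is [22 - s - e + b_3 + ... + b_6], so
   the last sum must reach [e + s - 4]. The inequality [e <= w + 1] settles [s <= 3]. *)
have [le3|gt3] := leqP (wt (free 6 x)) 3; first by lia.
have inb : free 6 x \in bits 6 by rewrite mem_bits size_free.
have [e4|ne4] := eqVneq (wt (free 6 x)) 4; last first.
  have /allP/(_ _ inb) : all (fun S => (4 < wt S) ==>
      (count (fun p => ~~ subb p S) (lev 6 2) <= 5 - 5 * (wt S == 6))) (bits 6).
    by vm_cast_no_check (erefl true).
  by lia.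
have inl : free 6 x \in lev 6 4 by rewrite mem_lev size_free e4 !eqxx.
have /allP/(_ _ inl)/andP[/eqP c9] : all (fun S =>
    (count (fun p => ~~ subb p S) (lev 6 2) == 9) &&
    (9 <= bound6 [seq ~~ subb p S | p <- lev 6 2])) (lev 6 4).
  by vm_cast_no_check (erefl true).
have [e9|] := eqVneq (wt (fbits 6 x)) 9; last by move: wle; rewrite c9; lia.
(* Nine edges is the extreme for four uncovered points: every pair not inside them is an edge, which
   determines the graph. *)
suff -> : [seq ~~ subb p (free 6 x) | p <- lev 6 2] = fbits 6 x by lia.
apply/eq_in_map => p pl.
have h : \sum_(p <- lev 6 2) ~~ subb p (free 6 x) <= \sum_(p <- lev 6 2) ~~ x p.
  by rewrite -!count_sum c9; move: e9; rewrite /wt /fbits count_map => <-.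
by have := sum_leq_eq (free_edges uo cx) h pl; case: (subb _ _); case: (x p).
Qed.

(** * Levels four to eight of a covering of the 8-cube *)

Section Eight.
Variable x : pred bitseq.
Hypothesis cx : cover 8 x.

Let b k := nlev 8 x k.

Lemma eight_ineqs :
  [/\ 1 <= b 7 + b 8, 8 <= 2 * b 6 + b 7, 28 <= 3 * b 5 + b 6 & 112 <= 6 * b 4 + 3 * b 5 + b 6].
Proof.
cov E8 8 [:: 0; 0; 0; 0; 0; 0; 0; 1; 1] 8 x cx; expand E8.
cov E7 8 [:: 0; 0; 0; 0; 0; 0; 2; 1] 7 x cx; expand E7.
cov E6 8 [:: 0; 0; 0; 0; 0; 3; 1] 6 x cx; expand E6.
have l6 y : cover 6 y -> 4 <= count y (lev 6 4 ++ lev 6 5 ++ lev 6 6).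
  move=> cy; rewrite !count_cat addnA; exact: local6.
lift E4 8 6 [:: 0; 0; 0; 0; 6; 3; 1] (lev 6 4 ++ lev 6 5 ++ lev 6 6) l6 cx; expand E4.
by rewrite /b; split; lia.
Qed.

Lemma tail_ge27 : 27 <= b 4 + b 5 + b 6 + b 7 + b 8.
Proof. by have [] := eight_ineqs; lia. Qed.

Lemma tail_ge13 : 13 <= b 5 + b 6 + b 7 + b 8.
Proof. by have [] := eight_ineqs; lia. Qed.

Lemma up_ge5 : 5 <= b 6 + b 7 + b 8.
Proof. by have [] := eight_ineqs; lia. Qed.

Lemma tail_eq13 : b 5 + b 6 + b 7 + b 8 = 13 -> b 5 = 8 /\ b 6 = 4.
Proof. by have [] := eight_ineqs; lia. Qed.

Lemma tail_eq27 : b 4 + b 5 + b 6 + b 7 + b 8 = 27 -> [/\ b 4 = 14, b 5 = 8 & b 6 = 4].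
Proof. by have [] := eight_ineqs; split; lia. Qed.

(* Every 6-set is covered and [3 * b 5 + b 6] equals 28, the number of 6-sets. *)
Lemma six_once V : b 5 = 8 -> b 6 = 4 -> V \in lev 8 6 -> count x (V :: down V) = 1.
Proof.
move=> b5 b6; have lc : lcheck 8 (nth 0 [:: 0; 0; 0; 0; 0; 3; 1])
    (flatten [seq V :: down V | V <- lev 8 6]) by vm_cast_no_check (erefl true).
have := count_levels x lc; rewrite -sum_count => e; expand e.
move: b5 b6; rewrite /b => b5 b6; rewrite b5 b6 in e.
have h1 W : W \in lev 8 6 -> 1 <= count x (W :: down W).
  rewrite mem_lev => /andP[/eqP sW _] /=.
  by have := cx sW; rewrite has_count; case: (x W).
have h2 : \sum_(W <- lev 8 6) count x (W :: down W) <= \sum_(W <- lev 8 6) 1.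
  by rewrite e sum_const_seq; vm_compute.
exact: (sum_leq_eq h1 h2).
Qed.

End Eight.

(** * Adjacent triples *)

Fixpoint pairs (T : Type) (l : seq T) :=
  if l is a :: l' then map (pair a) l' ++ pairs l' else [::].

Lemma count_pairs (T : Type) (x : pred T) l :
  count (fun p => x p.1 && x p.2) (pairs l) = 'C(count x l, 2).
Proof.
elim: l => //= a l IH; rewrite count_cat IH count_map.
have -> : count (preim (pair a) (fun p => x p.1 && x p.2)) l = x a * count x l.
  case xa : (x a); first by rewrite mul1n; apply: eq_count => i /=; rewrite xa.
  by rewrite mul0n (eq_count (a2 := pred0)) ?count_pred0 // => i /=; rewrite xa.
by case: (x a) => //=; rewrite mul1n add1n binS bin1 addnC.
Qed.

Fixpoint bleq (s t : bitseq) := match s, t with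
  | a :: s', c :: t' => if a == c then bleq s' t' else c
  | _, _ => true end.

Definition pair_le := relpre (fun p : bitseq * bitseq => p.1 ++ p.2) bleq.
Definition up_pairs := flatten [seq pairs (suplev 8 3 e) | e <- lev 8 2].
Definition down_pairs := flatten [seq pairs (sublev 8 3 K) | K <- lev 8 4].

Lemma pairs_check : sort pair_le up_pairs == sort pair_le down_pairs.
Proof. by vm_cast_no_check (erefl true). Qed.

Lemma sum_bin x l (r : seq bitseq) : \sum_(i <- r) 'C(count x (l i : seq bitseq), 2) =
  count (fun p => x p.1 && x p.2) (flatten [seq pairs (l i) | i <- r]).
Proof. by rewrite -sum_count; apply: eq_bigr => i _; rewrite count_pairs. Qed.

(** Two distinct triples share a pair exactly when they lie in a common 4-set; both sides count such
    pairs of member triples. *)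
Lemma sum_pairs (x : pred bitseq) :
  \sum_(e <- lev 8 2) 'C(count x (suplev 8 3 e), 2)
  = \sum_(K <- lev 8 4) 'C(count x (sublev 8 3 K), 2).
Proof.
have pu := permEl (perm_sort pair_le up_pairs).
have pd := permEl (perm_sort pair_le down_pairs).
rewrite (eqP pairs_check) perm_sym in pu.
have e := permP (perm_trans pu pd) (fun p => x p.1 && x p.2).
exact: (etrans (sum_bin x _ _) (etrans e (esym (sum_bin x _ _)))).
Qed.

Lemma triple_sums (x : pred bitseq) :
  \sum_(e <- lev 8 2) count x (suplev 8 3 e) = 3 * nlev 8 x 3 /\
  \sum_(K <- lev 8 4) count x (sublev 8 3 K) = 5 * nlev 8 x 3.
Proof.
have lc3 : lcheck 8 (nth 0 [:: 0; 0; 0; 3]) (flatten [seq suplev 8 3 e | e <- lev 8 2]).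
  by vm_cast_no_check (erefl true).
have lc5 : lcheck 8 (nth 0 [:: 0; 0; 0; 5]) (flatten [seq sublev 8 3 K | K <- lev 8 4]).
  by vm_cast_no_check (erefl true).
have := count_levels x lc3; rewrite -sum_count => e3; expand e3.
have := count_levels x lc5; rewrite -sum_count => e5; expand e5.
by split; [apply: (etrans e3) | apply: (etrans e5)]; lia.
Qed.

Lemma sumn_map (I : Type) (f : I -> nat) r : sumn (map f r) = \sum_(i <- r) f i.
Proof. by rewrite sumnE big_map. Qed.

(** Each inequality holds entry by entry, for [k = 0, ..., 4]. The entries will be the numbers of
    member triples in the 4-sets. *)
Lemma small_ineqs (ks : seq nat) : all (leq^~ 4) ks ->
  let s := sumn ks in let u := count_mem 0 ks in let n4 := count_mem 4 ks in
  let P := sumn [seq 'C(k, 2) | k <- ks] in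
  [/\ size ks <= s + u, P + 2 * size ks <= 2 * s + 2 * u,
      2 * P + 3 * size ks <= 3 * s + 3 * u + 3 * n4 & size ks + 3 * n4 <= s + u].
Proof.
elim: ks => //= k ks IH /andP[k4 /IH] {IH}.
by case: k k4 => [|[|[|[|[|]]]]] //= _ [h1 h2 h3 h4]; rewrite ?binE /=; split; lia.
Qed.

Section EightBound.
Variable x : pred bitseq.
Hypothesis cx : cover 8 x.

Let b k := nlev 8 x k.
Let kk K := count x (sublev 8 3 K).
Let ks := map kk (lev 8 4).

Lemma ks_le4 : all (leq^~ 4) ks.
Proof.
have /allP s4 : all (fun K => size (sublev 8 3 K) == 4) (lev 8 4) by vm_cast_no_check (erefl true).
by rewrite all_map; apply/allP => K Kl /=; rewrite -(eqP (s4 K Kl)) count_size.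
Qed.

Lemma size_ks : size ks = 70.
Proof. by rewrite size_map; vm_compute. Qed.

Lemma sum_ks : sumn ks = 5 * b 3.
Proof. by rewrite sumn_map; case: (triple_sums x). Qed.

(** A pair lying in [k] member triples satisfies [k <= 'C(k, 2) + 1]; this is summed over the 28
    pairs. *)
Lemma bin_ks : 3 * b 3 <= sumn [seq 'C(k, 2) | k <- ks] + 28.
Proof.
rewrite -map_comp sumn_map -(sum_pairs x); have [<- _] := triple_sums x.
have -> : 28 = size (lev 8 2) * 1 by vm_compute.
rewrite -sum_const_seq -big_split; apply: leq_sum => e _ /=.
by move: (count _ _) => [|[|[|n]]] //; rewrite binS bin1; lia.
Qed.

Lemma uncovered_ks : count_mem 0 ks <= b 4.
Proof.
rewrite count_map /b /nlev -!size_filter; apply: uniq_leq_size; first exact/filter_uniq/uniq_lev.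
move=> K; rewrite mem_filter => /andP[/= k0 KL]; rewrite mem_filter KL andbT.
move: KL; rewrite mem_lev => /andP[/eqP sK /eqP wK].
case/orP: (cover_sublev cx sK wK) => //; rewrite has_count; move: k0; rewrite /kk.
by move/eqP ->.
Qed.

(** All 4-sets without member triples are members; equality of the two counts leaves no other
    members of size 4. *)
Lemma tight_quads : b 4 = count_mem 0 ks -> forall K, K \in lev 8 4 -> x K -> kk K = 0.
Proof.
move=> e K KL xK.
have h1 K' : K' \in lev 8 4 -> (kk K' == 0 : nat) <= x K'.
  move=> KL'; move: (KL'); rewrite mem_lev => /andP[/eqP sK /eqP wK].
  case/orP: (cover_sublev cx sK wK) => [-> //|]; first by case: (_ == _).
  by rewrite has_count -/(kk K'); case: (kk K').
have h2 : \sum_(K' <- lev 8 4) x K' <= \sum_(K' <- lev 8 4) (kk K' == 0).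
  by rewrite -!count_sum; move: e; rewrite count_map /b /nlev => ->.
by have := sum_leq_eq h1 h2 KL; rewrite xK; case: eqP.
Qed.

End EightBound.

Lemma count_sub_in (T : eqType) (a c : pred T) l :
  (forall s, s \in l -> a s -> c s) -> count a l <= count c l.
Proof.
elim: l => //= s l IH ac; apply: leq_add.
  by have := ac s (mem_head _ _); case: (a s) => // ->.
by apply: IH => t tl; apply: ac; rewrite inE tl orbT.
Qed.

Lemma quad_five_check : all (fun K => all (fun W => all (fun K' =>
    has (fun R => subb R K') (sublev 8 3 K)) (sublev 8 4 W)) (suplev 8 5 K)) (lev 8 4).
Proof. by vm_cast_no_check (erefl true). Qed.

Lemma quad_six_check :
  all (fun K => has (fun V => 1 < count (subb K) (down V)) (lev 8 6)) (lev 8 4).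
Proof. by vm_cast_no_check (erefl true). Qed.

Section NoFullQuad.
Variable x : pred bitseq.
Hypothesis cx : cover 8 x.
Let b k := nlev 8 x k.
Let kk K := count x (sublev 8 3 K).

(** If all triples of [K] are members, so is each 5-set [W] above [K]: a member 4-set in [W] would
    contain a triple of [K], against [tight_quads]. But some 6-set contains two such [W], against
    [six_once]. *)
Lemma no_full_quad : b 5 = 8 -> b 6 = 4 -> b 4 = count_mem 0 (map kk (lev 8 4)) ->
  count_mem 4 (map kk (lev 8 4)) = 0.
Proof.
move=> b5 b6 b4; apply/eqP; rewrite -leqn0 leqNgt count_map -has_count.
apply/hasPn => K KL; apply/negP => /= /eqP k4.
have xs R : R \in sublev 8 3 K -> x R.
  apply/allP; rewrite all_count -/(kk K) k4.
  have /allP/(_ K KL)/eqP -> // : all (fun K => size (sublev 8 3 K) == 4) (lev 8 4).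
  by vm_cast_no_check (erefl true).
have x5 W : W \in lev 8 5 -> subb K W -> x W.
  move=> WL KW; move: (WL); rewrite mem_lev => /andP[/eqP sW /eqP wW].
  case/orP: (cover_sublev cx sW wW) => // /hasP[K' K'W xK'].
  have K'L : K' \in lev 8 4 by move: K'W; rewrite mem_filter => /andP[].
  have := tight_quads cx b4 K'L xK'; move/eqP; rewrite eqn0Ngt -has_count; case/hasP.
  have Wsup : W \in suplev 8 5 K by rewrite mem_filter KW WL.
  have /allP/(_ _ KL)/allP/(_ _ Wsup)/allP/(_ _ K'W)/hasP[R RK RK'] := quad_five_check.
  exists R; last exact: xs.
  by move: RK; rewrite mem_filter => /andP[_ RL]; rewrite mem_filter RK' RL.
have /allP/(_ K KL)/hasP[V VL two] := quad_six_check.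
have := six_once cx b5 b6 VL; rewrite /=.
have : count (subb K) (down V) <= count x (down V).
  apply: count_sub_in => W WV; apply: x5.
  have [_ w] := down_sub WV; move: VL; rewrite !mem_lev (size_down WV) => /andP[-> /=].
  by rewrite w eqSS.
by move: two; lia.
Qed.

End NoFullQuad.

(** * A propagating search for cardinality constraints *)

(* Leaves hold 0 (false), 1 (true) or 2 (unassigned). *)
Fixpoint update t (s : bitseq) a :=
  match t, s with
  | Leaf _, _ => Leaf a
  | Node l r, c :: s' => if c then Node l (update r s' a) else Node (update l s' a) r
  | Node _ _, [::] => t
  end.

(** A triple [(l, lo, hi)] demands between [lo] and [hi] members in the list [l]. *)
Definition constr := (seq bitseq * nat * nat)%type.

Definition assign t l a := foldl (fun t s => update t s a) t l.

Definition step (st : option tree * bool) (k : constr) :=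
  let: (l, lo, hi) := k in
  if st.1 is Some t then
    let vals := map (query t) l in
    let t1 := count_mem 1 vals in
    let t2 := count (ltn 1) vals in
    if (hi < t1) || (t1 + t2 < lo) then (None, false)
    else if t2 == 0 then st
    else if t1 == hi then (Some (assign t [seq s <- l | 1 < query t s] 0), true)
    else if t1 + t2 == lo then (Some (assign t [seq s <- l | 1 < query t s] 1), true)
    else st
  else st.

Fixpoint propagate fuel (ks : seq constr) t :=
  if fuel is f.+1 then
    let st := foldl step (Some t, false) ks in
    if st.1 is Some t' then if st.2 then propagate f ks t' else Some t' else None
  else Some t.

(** The answer [true] certifies that no assignment extending [t] meets the constraints. Exhausted
    fuel, or no variable left to branch on, yields [false]. *)
Fixpoint refute fuel ks vars t :=
  if fuel is f.+1 then
    if propagate 20 ks t is Some t' then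
      if [seq s <- vars | 1 < query t' s] is v :: _ then
        if refute f ks vars (update t' v 1) then refute f ks vars (update t' v 0) else false
      else false
    else true
  else false.

Section Sound.
Variables (n : nat) (x : pred bitseq).

Definition sat (k : constr) :=
  let: (l, lo, hi) := k in all (fun s => size s == n) l && (lo <= count x l <= hi).

Definition agrees t := forall s, size s = n ->
  (query t s = 1 -> x s) /\ (query t s = 0 -> ~~ x s).

Fixpoint full m t :=
  match m, t with
  | 0, Leaf _ => true
  | m'.+1, Node l r => full m' l && full m' r
  | _, _ => false
  end.

Lemma query_update m t s a u : full m t -> size s = m -> size u = m ->
  query (update t s a) u = if u == s then a else query t u.
Proof.
elim: m t s u => [|m IH] [a'|l r] // [|c s] [|d u] //= /andP[fl fr] [ss] [su].
by rewrite eqseq_cons; case: c; case: d => //=; rewrite IH.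
Qed.

Lemma full_update m t s a : full m t -> size s = m -> full m (update t s a).
Proof.
elim: m t s => [|m IH] [a'|l r] // [|c s] //= /andP[fl fr] [ss].
by case: c => /=; rewrite IH ?fl ?fr.
Qed.

Lemma agrees_assign t l (a : bool) : full n t -> agrees t ->
  (forall s, s \in l -> size s = n /\ x s = a) ->
  full n (assign t l a) /\ agrees (assign t l a).
Proof.
elim: l t => //= s l IH t ft agt h; have [ss xs] := h s (mem_head _ _).
apply: IH; first exact: full_update.
- move=> u su; rewrite (query_update _ ft) //.
  have [->|ne] := eqVneq u s; last exact: agt.
  by rewrite xs; case: (a).
- by move=> u ul; apply: h; rewrite inE ul orbT.
Qed.

Definition good (st : option tree * bool) :=
  if st.1 is Some t then full n t /\ agrees t else False.

Lemma step_good st k : good st -> sat k -> good (step st k).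
Proof.
case: st k => [[t|] ch] [[l lo] hi] //= [ft agt] /andP[/allP sl /andP[lo_x x_hi]].
set t1 := count_mem 1 _; set t2 := count (ltn 1) _.
pose un := [seq s <- l | 1 < query t s].
have e2 : t2 = size un by rewrite /t2 count_map size_filter.
have split_x : count x l = t1 + count x un.
  rewrite /t1 /un count_map; elim: l sl {lo_x x_hi t1 t2 un e2} => //= s l IH sl.
  have [a1 a0] := agt s (eqP (sl s (mem_head _ _))).
  rewrite IH => [|u ul]; last by apply: sl; rewrite inE ul orbT.
  case q : (query t s) a1 a0 => [|[|m]] /= a1 a0; last by lia.
    by rewrite (negbTE (a0 erefl)).
  by rewrite (a1 erefl); lia.
have sun s : s \in un -> size s = n by rewrite mem_filter => /andP[_ /sl/eqP].
have le_un : count x un <= t2 by rewrite e2 count_size.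
case: ifP => [/orP[]|_]; [lia|lia|].
case: ifP => // _; case: eqP => [e|_].
  apply: (agrees_assign (a := false)) => // s sin; split; first exact: sun.
  apply/negbTE/negP => xs; suff : 0 < count x un by lia.
  by rewrite -has_count; apply/hasP; exists s.
case: eqP => [e|//].
apply: (agrees_assign (a := true)) => // s sin; split; first exact: sun.
have /allP/(_ s sin) // : all x un.
by rewrite all_count eqn_leq count_size /= -e2; lia.
Qed.

Lemma propagate_good fuel ks t : all sat ks -> full n t -> agrees t ->
  if propagate fuel ks t is Some t' then full n t' /\ agrees t' else False.
Proof.
elim: fuel t => //= f IH t sk ft agt.
have : good (foldl step (Some t, false) ks).
  have : good (Some t, false) by [].
  elim: ks (Some t, false) sk {IH} => //= k ks IH st /andP[sk1 sk] g.
  by apply: IH => //; apply: step_good.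
by case: (foldl _ _ _) => [[t'|] []] //= [ft' agt']; apply: IH.
Qed.

Arguments propagate : simpl never.

Lemma refute_sound fuel ks vars t : all sat ks -> all (fun s => size s == n) vars ->
  full n t -> agrees t -> ~~ refute fuel ks vars t.
Proof.
elim: fuel t => //= f IH t sk sv ft agt.
have := propagate_good 20 sk ft agt.
case: (propagate _ _ _) => // t' [ft' agt'].
case E : [seq s <- vars | 1 < query t' s] => [|v vs] //.
have sv1 : size v = n.
  have : v \in [seq s <- vars | 1 < query t' s] by rewrite E mem_head.
  by rewrite mem_filter => /andP[_ /(allP sv)/eqP].
have upd (a : bool) : x v = a -> ~~ refute f ks vars (update t' v a).
  move=> xv; have [] := @agrees_assign t' [:: v] a ft' agt'; last exact: IH.
  by move=> s; rewrite inE => /eqP ->.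
case xv : (x v); case: ifP => // r; last exact: (upd false).
by have := upd true xv; rewrite r.
Qed.
End Sound.

(** Consequences of [b_4 = 14], [b_5 = 8], [b_6 = 4], in order: a 6-set contains three member 4-sets
    and at most one member 5-set, a 7-set contains three member 5-sets, and every 5-set is
    covered. *)
Definition quad_constrs :=
  [seq (sublev 8 4 V, 3, 3) | V <- lev 8 6] ++ [seq (down V, 0, 1) | V <- lev 8 6] ++
  [seq (map (fill P) (lev 7 5), 3, 3) | P <- lev 8 7] ++
  [seq (W :: down W, 1, 6) | W <- lev 8 5].

Definition quad0 := nseq 4 true ++ nseq 4 false.
Definition quad1 := [:: true; true; true; false; true; false; false; false].

(** Branching starts with the 4-sets lying mostly in the first five points, the union of [quad0] and
    [quad1]. *)
Definition quad_vars :=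
  flatten [seq [seq K <- lev 8 4 | wt (take 5 K) == j] | j <- [:: 4; 3; 2; 1]] ++ lev 8 5.

Definition quad_start := update (update (build 8 (fun=> 2)) quad0 1) quad1 1.

Lemma quad_check : refute 200 quad_constrs quad_vars quad_start.
Proof. by vm_cast_no_check (erefl true). Qed.

(** * Steiner quadruple systems *)

Definition meet (s t : bitseq) : bitseq := [seq p.1 && p.2 | p <- zip s t].

Section Tight.
Variable x : pred bitseq.
Hypothesis cx : cover 8 x.
Hypothesis b4 : nlev 8 x 4 = 14.
Hypothesis b5 : nlev 8 x 5 = 8.
Hypothesis b6 : nlev 8 x 6 = 4.

(** Since [6 * 14 + 3 * 8 + 4 = 28 * 4], the bound [local6] is tight on every 6-set; by [six_once]
    exactly one of the four members has size 5 or 6. *)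
Lemma three_quads V : V \in lev 8 6 -> count x (sublev 8 4 V) = 3.
Proof.
pose loc V := map (fill V) (lev 6 4 ++ lev 6 5 ++ lev 6 6).
have lc : lcheck 8 (nth 0 [:: 0; 0; 0; 0; 6; 3; 1]) (flatten [seq loc V | V <- lev 8 6]).
  by vm_cast_no_check (erefl true).
have := count_levels x lc; rewrite -sum_count => e; expand e; rewrite b4 b5 b6 in e.
have h1 W : W \in lev 8 6 -> 4 <= count x (loc W).
  rewrite mem_lev => /andP[/eqP sW /eqP wW]; rewrite count_map !count_cat addnA.
  exact: (local6 (face_cover cx sW wW)).
have h2 : \sum_(W <- lev 8 6) count x (loc W) <= \sum_(W <- lev 8 6) 4.
  by apply: (leq_trans (eq_leq e)); rewrite sum_const_seq; vm_compute.
move=> VL; have := sum_leq_eq h1 h2 VL; rewrite /loc map_cat count_cat.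
have /allP/(_ V VL)/andP[/eqP -> /permP/(_ x) ->] : all (fun V =>
    (map (fill V) (lev 6 4) == sublev 8 4 V) &&
    perm_eq (map (fill V) (lev 6 5 ++ lev 6 6)) (V :: down V)) (lev 8 6).
  by vm_cast_no_check (erefl true).
by rewrite (six_once cx b5 b6 VL); lia.
Qed.

(** By [six_once] the seven 6-sets of a 7-set give [2 * b_5 + b_6 = 7] inside it, so [b_5 <= 3]
    there. The sum over the eight 7-sets is [3 * 8], which forces equality. *)
Lemma three_fives P : P \in lev 8 7 -> count x (map (fill P) (lev 7 5)) = 3.
Proof.
have lc : lcheck 8 (nth 0 [:: 0; 0; 0; 0; 0; 3]) (flatten [seq map (fill P) (lev 7 5) | P <- lev 8 7]).
  by vm_cast_no_check (erefl true).
have := count_levels x lc; rewrite -sum_count => e; expand e; rewrite b5 in e.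
have h1 W : W \in lev 8 7 -> count x (map (fill W) (lev 7 5)) <= 3.
  rewrite mem_lev => /andP[/eqP sW /eqP wW]; rewrite count_map.
  have lc7 : lcheck 7 (nth 0 [:: 0; 0; 0; 0; 0; 2; 1]) (flatten [seq V :: down V | V <- lev 7 6]).
    by vm_cast_no_check (erefl true).
  have := count_levels (x \o fill W) lc7; rewrite -sum_count => e7; expand e7.
  have s7 : \sum_(i <- lev 7 6) count (x \o fill W) (i :: down i) = size (lev 7 6) * 1.
    rewrite -sum_const_seq; apply: eq_big_seq => V; rewrite mem_lev => /andP[/eqP sV /eqP wV].
    have e1 : count x (fill W V :: down (fill W V)) = 1.
      by apply: (six_once cx b5 b6); rewrite mem_lev size_fill sW wt_fill ?wV ?sV.
    rewrite (down_fill (etrans sV (esym wW))) in e1; apply: etrans e1.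
    by rewrite -[fill W V :: _]/(map (fill W) (V :: down V)) count_map.
  have {s7 e7} := etrans (esym e7) s7; have -> : size (lev 7 6) = 7 by vm_compute.
  by rewrite -/(nlev 7 (x \o fill W) 5); lia.
have h2 : \sum_(W <- lev 8 7) 3 <= \sum_(W <- lev 8 7) count x (map (fill W) (lev 7 5)).
  by apply: (leq_trans _ (eq_leq (esym e))); rewrite sum_const_seq; vm_compute.
by move=> PL; have := sum_leq_eq h1 h2 PL.
Qed.

Lemma quad_sat : all (sat 8 x) quad_constrs.
Proof.
have size_ok : all (fun k : constr => all (fun s => size s == 8) k.1.1) quad_constrs.
  by vm_cast_no_check (erefl true).
apply/allP => k kin; have := allP size_ok _ kin.
have one V : V \in lev 8 6 -> count x (down V) <= 1.
  by move=> VL; have := six_once cx b5 b6 VL; rewrite /=; lia.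
move: kin; rewrite !mem_cat => /or4P[] /mapP[V VL ->] /= ->.
- by rewrite (three_quads VL).
- by rewrite (one _ VL).
- by rewrite (three_fives VL).
move: VL; rewrite mem_lev => /andP[/eqP sV /eqP wV].
have sd : size (down V) = 5.
  have /allP/(_ V) : all (fun V => size (down V) == 5) (lev 8 5) by vm_cast_no_check (erefl true).
  by rewrite mem_lev sV wV => /(_ isT)/eqP.
have := count_size x (V :: down V); rewrite /= sd => ->; rewrite andbT.
by have := cx sV; rewrite has_count; case: (x V).
Qed.

Lemma not_both : ~~ (x quad0 && x quad1).
Proof.
apply/negP => /andP[x0 x1].
have := @refute_sound 8 x 200 quad_constrs quad_vars quad_start quad_sat.
rewrite quad_check => h; suff : ~~ true by []; apply: h.
- by vm_cast_no_check (erefl true).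
- by vm_cast_no_check (erefl true).
move=> s ss; rewrite /quad_start.
have f0 : full 8 (build 8 (fun=> 2)) by vm_cast_no_check (erefl true).
rewrite (query_update _ (full_update _ f0 _)) // (query_update _ f0) // query_build //.
by do 2?case: eqP => [->|_].
Qed.
End Tight.

(* An ordering of the points that carries two 4-sets with a common triple to [quad0] and [quad1]. *)
Definition std_order (K K' : bitseq) :=
  [seq i <- iota 0 8 | nth false K i && nth false K' i] ++
  [seq i <- iota 0 8 | nth false K i && ~~ nth false K' i] ++
  [seq i <- iota 0 8 | ~~ nth false K i && nth false K' i] ++
  [seq i <- iota 0 8 | ~~ nth false K i && ~~ nth false K' i].

Lemma std_order_check : all (fun K => all (fun K' =>
   let o := std_order K K' in
   [&& perm_eq o (iota 0 8), pm o K == quad0 & pm o K' == quad1])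
   [seq K' <- lev 8 4 | wt (meet K K') == 3]) (lev 8 4).
Proof. by vm_cast_no_check (erefl true). Qed.

Lemma meet_check : all (fun R => all (fun K => all (fun K' =>
   (K == K') || (wt (meet K K') == 3)) (suplev 8 4 R)) (suplev 8 4 R)) (lev 8 3).
Proof. by vm_cast_no_check (erefl true). Qed.

Lemma count_le1 (T : eqType) (a : pred T) l : uniq l ->
  {in l &, forall s t, a s -> a t -> s = t} -> count a l <= 1.
Proof.
move=> ul h; rewrite -size_filter.
have : uniq [seq s <- l | a s] by apply: filter_uniq.
case E : [seq s <- l | a s] => [|s [|t l']] //= /andP[].
have in_E u : u \in [seq s <- l | a s] -> u \in l /\ a u by rewrite mem_filter => /andP[].
have [sl sa] := in_E s ltac:(by rewrite E mem_head).
have [tl ta] := in_E t ltac:(by rewrite E !inE eqxx orbT).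
by rewrite (h s t sl tl sa ta) inE eqxx.
Qed.

Lemma count_ge2 (T : eqType) (a : pred T) l s t : s \in l -> t \in l -> s != t ->
  a s -> a t -> 1 < count a l.
Proof.
move=> sl tl ne sa ta; rewrite -size_filter -[2]/(size [:: s; t]).
apply: uniq_leq_size; first by rewrite /= inE ne.
by move=> u; rewrite !inE mem_filter => /orP[] /eqP ->; rewrite ?sa ?ta.
Qed.

Definition join (s t : bitseq) : bitseq := [seq p.1 || p.2 | p <- zip s t].

Lemma star_quads_check : all (fun e => all (fun R1 => all (fun R2 => all (fun R3 =>
   if R1 == R2 then true else if R1 == R3 then true else if R2 == R3 then true else
   let K := join R1 R2 in let K' := join R1 R3 in
   [&& (size K == 8) && (wt K == 4), (size K' == 8) && (wt K' == 4), K != K',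
       subb R1 K && subb R2 K & subb R1 K' && subb R3 K'])
   (suplev 8 3 e)) (suplev 8 3 e)) (suplev 8 3 e)) (lev 8 2).
Proof. by vm_cast_no_check (erefl true). Qed.

Section Steiner.
Variable x : pred bitseq.
Hypothesis cx : cover 8 x.
Hypothesis tight : nlev 8 x 4 + nlev 8 x 5 + nlev 8 x 6 + nlev 8 x 7 + nlev 8 x 8 = 27.

(** A permutation carries the two blocks to [quad0] and [quad1]; its inverse transports the
    covering, and [not_both] applies. *)
Lemma blocks_meet K K' : K \in lev 8 4 -> K' \in lev 8 4 -> x K -> x K' ->
  wt (meet K K') != 3.
Proof.
move=> KL K'L xK xK'; apply/negP => w3.
have [b4 b5 b6] := tail_eq27 cx tight.
have K'in : K' \in [seq K' <- lev 8 4 | wt (meet K K') == 3] by rewrite mem_filter w3 K'L.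
have := allP (allP std_order_check K KL) K' K'in; cbv beta zeta.
set o := std_order K K' => /and3P[po /eqP oK /eqP oK'].
have pq := perm_inv_perm po.
have sz L : L \in lev 8 4 -> size L = 8 by rewrite mem_lev => /andP[/eqP].
have := @not_both (x \o pm (inv_perm 8 o)) (cover_pm pq cx).
rewrite !(count_pm _ _ pq) => /(_ b4 b5 b6)/negP; apply.
rewrite -oK -oK'; change (x (pm (inv_perm 8 o) (pm o K)) && x (pm (inv_perm 8 o) (pm o K'))).
by rewrite !(inv_permK po) ?sz // xK xK'.
Qed.

(** By [blocks_meet] a triple lies in at most one block, and the blocks contain [14 * 4 = 56]
    triples, as many as there are. *)
Lemma one_block R : R \in lev 8 3 -> count x (suplev 8 4 R) = 1.
Proof.
have [b4 b5 b6] := tail_eq27 cx tight.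
have le1 S : S \in lev 8 3 -> count x (suplev 8 4 S) <= 1.
  move=> SL; apply: count_le1; first exact/filter_uniq/uniq_lev.
  move=> K K' KS K'S xK xK'.
  have /allP/(_ S SL)/allP/(_ K KS)/allP/(_ K' K'S)/orP[/eqP //|w3] := meet_check.
  have inL L : L \in suplev 8 4 S -> L \in lev 8 4 by rewrite mem_filter => /andP[].
  by have := blocks_meet (inL K KS) (inL K' K'S) xK xK'; rewrite w3.
have lc : lcheck 8 (nth 0 [:: 0; 0; 0; 0; 4]) (flatten [seq suplev 8 4 R | R <- lev 8 3]).
  by vm_cast_no_check (erefl true).
have := count_levels x lc; rewrite -sum_count => e; expand e; rewrite b4 in e.
have h2 : \sum_(S <- lev 8 3) 1 <= \sum_(S <- lev 8 3) count x (suplev 8 4 S).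
  by apply: (leq_trans _ (eq_leq (esym e))); rewrite sum_const_seq; vm_compute.
by move=> RL; have := sum_leq_eq le1 h2 RL.
Qed.

Let kk K := count x (sublev 8 3 K).

Lemma block_triples : \sum_(K <- lev 8 4) x K * kk K = nlev 8 x 3.
Proof.
rewrite /nlev count_sum.
have e1 K : x K * kk K = \sum_(R <- lev 8 3) x R * (subb R K && x K).
  rewrite /kk count_filter count_sum big_distrr /=; apply: eq_bigr => R _.
  by case: (x K); case: (x R); case: (subb R K).
apply: (etrans (eq_bigr _ (fun K _ => e1 K))).
apply: (etrans (exchange_big _ _ _ _ _ _)); apply: eq_big_seq => R RL.
rewrite -big_distrr /=.
suff -> : \sum_(K <- lev 8 4) (subb R K && x K) = 1 by rewrite muln1.
rewrite -(count_sum (fun K => subb R K && x K)); apply: etrans (one_block RL).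
rewrite [RHS]count_filter; apply: eq_count => K /=; exact: andbC.
Qed.

Lemma nonblock K : K \in lev 8 4 -> (~~ x K : nat) <= ~~ x K * kk K.
Proof.
rewrite mem_lev => /andP[/eqP sK /eqP wK]; case/orP: (cover_sublev cx sK wK) => [->//|].
by rewrite has_count -/(kk K); case: (x K); lia.
Qed.

(** Each member triple lies in five 4-sets, exactly one of which is a block. *)
Lemma nonblock_sum : \sum_(K <- lev 8 4) ~~ x K * kk K = 4 * nlev 8 x 3.
Proof.
have [_ s5] := triple_sums x.
have : \sum_(K <- lev 8 4) (x K * kk K + ~~ x K * kk K) = 5 * nlev 8 x 3.
  by apply: etrans s5; apply: eq_bigr => K _; rewrite -/(kk K); case: (x K); lia.
by rewrite big_split /= block_triples; lia.
Qed.

Lemma nonblock_count : \sum_(K <- lev 8 4) (~~ x K : nat) = 56.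
Proof.
have [b4 _ _] := tail_eq27 cx tight.
rewrite -(count_sum (predC x)); have := count_predC x (lev 8 4).
have -> : size (lev 8 4) = 70 by vm_compute.
by move: b4; rewrite /nlev => ->; lia.
Qed.

(** The 56 non-blocks each contain a member triple, and each member triple serves four of them. *)
Lemma triples_ge14 : 14 <= nlev 8 x 3.
Proof.
have : \sum_(K <- lev 8 4) (~~ x K : nat) <= \sum_(K <- lev 8 4) ~~ x K * kk K.
  by rewrite big_seq [leqRHS]big_seq; apply: leq_sum nonblock.
by rewrite nonblock_count nonblock_sum; lia.
Qed.

(** With only 14 member triples every non-block contains exactly one. The unions of [R1] with [R2]
    and of [R1] with [R3] contain two each, so both are blocks; but both contain [R1], against
    [one_block]. *)
Lemma star_triples : has (fun e => 2 < count x (suplev 8 3 e)) (lev 8 2) -> 15 <= nlev 8 x 3.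
Proof.
case/hasP => e eL star; rewrite ltn_neqAle triples_ge14 andbT; apply/negP => /eqP a14.
have h2 : \sum_(K <- lev 8 4) ~~ x K * kk K <= \sum_(K <- lev 8 4) (~~ x K : nat).
  by rewrite nonblock_count nonblock_sum -a14.
have kk1 K : K \in lev 8 4 -> ~~ x K -> kk K = 1.
  by move=> KL nx; have := sum_leq_eq nonblock h2 KL; rewrite nx mul1n.
have : 2 < size [seq R <- suplev 8 3 e | x R] by rewrite size_filter.
have : uniq [seq R <- suplev 8 3 e | x R] by apply/filter_uniq/filter_uniq/uniq_lev.
case E : [seq R <- suplev 8 3 e | x R] => [|R1 [|R2 [|R3 l]]] //= /and3P[n1 n2 _] _.
have in_E R : R \in [:: R1, R2, R3 & l] -> R \in suplev 8 3 e /\ x R.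
  by rewrite -E mem_filter => /andP[].
have [e1 x1] := in_E R1 (mem_head _ _).
have [e2 x2] := in_E R2 ltac:(by rewrite !inE eqxx orbT).
have [e3 x3] := in_E R3 ltac:(by rewrite !inE eqxx !orbT).
move: n1 n2; rewrite !inE !negb_or => /and3P[n12 n13 _] /andP[n23 _].
have := allP (allP (allP (allP star_quads_check e eL) R1 e1) R2 e2) R3 e3.
rewrite (negbTE n12) (negbTE n13) (negbTE n23); cbv beta zeta.
set K := join R1 R2; set K' := join R1 R3.
case/and5P=> /andP[sK wK] /andP[sK' wK'] nKK' /andP[s1 s2] /andP[s1' s3'].
have KL : K \in lev 8 4 by rewrite mem_lev sK wK.
have K'L : K' \in lev 8 4 by rewrite mem_lev sK' wK'.
have blk L S : L \in lev 8 4 -> subb R1 L -> S \in suplev 8 3 e -> R1 != S -> x S -> subb S L -> x L.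
  move=> LL R1L Se ne xS SL; apply/negPn/negP => nx.
  have inS T : T \in suplev 8 3 e -> subb T L -> T \in sublev 8 3 L.
    by rewrite mem_filter => /andP[_ TL3] TL; rewrite mem_filter TL TL3.
  have := count_ge2 (inS _ e1 R1L) (inS _ Se SL) ne x1 xS.
  by rewrite -/(kk L) kk1.
have xK := blk K R2 KL s1 e2 n12 x2 s2.
have xK' := blk K' R3 K'L s1' e3 n13 x3 s3'.
have R1L : R1 \in lev 8 3 by move: e1; rewrite mem_filter => /andP[].
have KR : K \in suplev 8 4 R1 by rewrite mem_filter s1 KL.
have K'R : K' \in suplev 8 4 R1 by rewrite mem_filter s1' K'L.
by have := count_ge2 KR K'R nKK' xK xK'; rewrite (one_block R1L).
Qed.

End Steiner.

(** * At least 41 sets of size three or more *)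

Section Upper.
Variable x : pred bitseq.
Hypothesis cx : cover 8 x.
Let b k := nlev 8 x k.

Lemma upper_ge41 : 41 <= b 3 + (b 4 + b 5 + b 6 + b 7 + b 8).
Proof.
have t27 := tail_ge27 cx; have t13 := tail_ge13 cx.
have := small_ineqs (ks_le4 x); cbv zeta; rewrite size_ks sum_ks.
have := bin_ks x; have := uncovered_ks cx; have full := @no_full_quad x cx.
have e13 := tail_eq13 cx; have st := @triples_ge14 x cx.
move: full; set ks := map _ _; move: (count_mem 4 ks) (count_mem 0 ks) (sumn _) => n4 u P.
rewrite -!/(b _) in t27 t13 e13 st *.
move: (b 3) (b 4) (b 5) (b 6) (b 7) (b 8) t27 t13 e13 st => a b4 b5 b6 b7 b8.
move=> t27 t13 e13 st full ub P28 [h1 h2 h3 h4].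
rewrite leqNgt; apply/negP => lt41.
(* At least [70 - 5 * a] of the 4-sets contain no member triple and are therefore members. *)
have [a10|a11] := leqP a 10; first lia.
(* Only [a = 13] with a tail of exactly 27 could fail, and that tail forces 14 triples. *)
have [a13|a13] := leqP 13 a; first by have := st ltac:(lia); lia.
have [ea|ea] : a = 11 \/ a = 12 by lia.
  by subst a; lia.
(* For [a = 12] a total below 41 forces [u = b4 = 15], [n4 = 1] and 13 members of size at least 5, a
   situation excluded by [no_full_quad]. *)
subst a; have [e5 e6] : b5 = 8 /\ b6 = 4 by apply: e13; lia.
have n40 : n4 = 0 by apply: full => //; lia.
lia.
Qed.

End Upper.

(** * The graph of uncovered pairs *)

Definition face_masks := [seq [seq subb p V | p <- lev 8 2] | V <- lev 8 6].
Definition excess t F := sumn [seq query t (mask m F) | m <- face_masks].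
(** By [graph_ok] the subtraction never truncates. *)
Definition excess_tab := build 15 (fun F => bound6 F - 8).

Lemma query_excess F : size F = 15 -> query excess_tab F = bound6 F - 8.
Proof. by move=> sF; rewrite /excess_tab query_build. Qed.

Opaque excess_tab.

(** The pairs of a face are listed in the same order as in the cube, so restricting a graph to a
    6-set is masking its edge vector. *)
Lemma face_check : all (fun V => map (fill V) (lev 6 2) == sublev 8 2 V) (lev 8 6).
Proof. by vm_cast_no_check (erefl true). Qed.

Lemma face_fbits x V : V \in lev 8 6 ->
  fbits 6 (x \o fill V) = mask [seq subb p V | p <- lev 8 2] (fbits 8 x).
Proof.
move=> VL; rewrite /fbits (mask_map (subb^~ V)).
apply: (etrans _ (congr1 (map (fun p => ~~ x p)) (eqP (allP face_check V VL)))).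
by rewrite -map_comp; apply: eq_map.
Qed.

Lemma size_fbits6 x : size (fbits 6 x) = 15.
Proof. by rewrite size_map; vm_compute. Qed.

Lemma fbits6_ok x : graph_ok (fbits 6 x).
Proof. by apply: (allP graph_check); rewrite mem_bits size_fbits6. Qed.

Lemma count_cat4 (T : Type) (a : pred T) s1 s2 s3 s4 :
  count a (s1 ++ s2 ++ s3 ++ s4) = count a s1 + (count a s2 + count a s3 + count a s4).
Proof. by rewrite !count_cat !addnA. Qed.

Section Graph.
Variable x : pred bitseq.
Hypothesis cx : cover 8 x.
Let b k := nlev 8 x k.
Let F := fbits 8 x.
Let E := excess excess_tab F.
Let F6 V := fbits 6 (x \o fill V).

Lemma excess_sum : E + 224 = \sum_(V <- lev 8 6) bound6 (F6 V).
Proof.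
have -> : 224 = \sum_(V <- lev 8 6) 8 by rewrite sum_const_seq; vm_compute.
rewrite /E /excess /face_masks -map_comp sumn_map -big_split.
apply: eq_big_seq => V VL; rewrite /comp -(face_fbits x VL).
rewrite query_excess; last exact: size_fbits6.
by apply: subnK; have /and3P[] := fbits6_ok (x \o fill V).
Qed.

Lemma edges_sum : \sum_(V <- lev 8 6) wt (F6 V) = 15 * wt F.
Proof.
have lc : lcheck 8 (nth 0 [:: 0; 0; 15]) (flatten [seq sublev 8 2 V | V <- lev 8 6]).
  by vm_cast_no_check (erefl true).
have := count_levels (predC x) lc; rewrite -sum_count => e; expand e.
rewrite {2}/wt /F /fbits count_map.
have -> : count (preim (fun p => ~~ x p) id) (lev 8 2) = nlev 8 (predC x) 2 by [].
apply: (@etrans _ _ (\sum_(V <- lev 8 6) count (predC x) (sublev 8 2 V))); last first.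
  by apply: (etrans e); lia.
apply: eq_big_seq => V VL; rewrite /F6 (face_fbits x VL) /fbits (mask_map (subb^~ V)).
by rewrite /wt count_map.
Qed.

(** The two affine bounds of [graph_ok] summed over the 28 six-sets, each pair lying in 15 of
    them. *)
Lemma excess_edges : 15 * wt F <= E + 252 /\ 45 * wt F <= 2 * E + 784.
Proof.
have aff a c : \sum_(V <- lev 8 6) (a * bound6 (F6 V) + c) = a * (E + 224) + 28 * c.
  rewrite excess_sum big_distrr; apply: (etrans (big_split _ _ _ _ _)); congr addn.
  by rewrite sum_const_seq; congr muln; vm_compute.
split.
  rewrite -edges_sum; apply: (@leq_trans (1 * (E + 224) + 28 * 1)); last by lia.
  rewrite -aff; apply: leq_sum => V _; rewrite mul1n addn1.
  by have /and3P[] := fbits6_ok (x \o fill V).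
have -> : 45 = 3 * 15 by [].
rewrite -mulnA -edges_sum big_distrr.
apply: (@leq_trans (2 * (E + 224) + 28 * 12)); last by lia.
rewrite -aff; apply: leq_sum => V _.
by have /and3P[] := fbits6_ok (x \o fill V).
Qed.

Lemma excess_faces : E + 224 <= 10 * b 3 + 6 * b 4 + 3 * b 5 + b 6.
Proof.
have lc : lcheck 8 (nth 0 [:: 0; 0; 0; 10; 6; 3; 1])
    (flatten [seq map (fill V) (lev 6 3 ++ lev 6 4 ++ lev 6 5 ++ lev 6 6) | V <- lev 8 6]).
  by vm_cast_no_check (erefl true).
have h V : size V = 8 -> wt V = 6 ->
    bound6 (F6 V) <= count (x \o fill V) (lev 6 3 ++ lev 6 4 ++ lev 6 5 ++ lev 6 6).
  move=> sV wV; apply: leq_trans (six_bound _ (face_cover cx sV wV)) _.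
  by rewrite /nlev; exact: eq_leq (esym (count_cat4 _ _ _ _ _)).
have := @face_dc 8 6 _ _ (fun V => bound6 (F6 V)) x lc h.
by move=> /(leq_trans (eq_leq excess_sum)) e; expand e; rewrite /b; lia.
Qed.

(** Add to [excess_faces] 4 times [tail_ge27], 3 times [tail_ge13], twice [up_ge5] and
    [1 <= b 7 + b 8]: all coefficients become 10, and [224 + 108 + 39 + 10 + 1 = 382]. *)
Lemma excess_total : E + 382 <= 10 * (b 3 + (b 4 + b 5 + b 6 + b 7 + b 8)).
Proof.
have := excess_faces; have := tail_ge27 cx; have := tail_ge13 cx; have := up_ge5 cx.
have [] := eight_ineqs cx; rewrite /b; lia.
Qed.

Lemma excess_total28 : 28 <= b 4 + b 5 + b 6 + b 7 + b 8 ->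
  E + 386 <= 10 * (b 3 + (b 4 + b 5 + b 6 + b 7 + b 8)).
Proof.
have := excess_faces; have := tail_ge13 cx; have := up_ge5 cx.
have [] := eight_ineqs cx; rewrite /b; lia.
Qed.

Definition star8 G := has (fun p => 2 < count (fun R => all id (mask [seq subb e R | e <- lev 8 2] G))
  (suplev 8 3 p)) (lev 8 2).

(** Triangles of uncovered pairs are member triples. *)
Lemma star8P : star8 F -> has (fun e => 2 < count x (suplev 8 3 e)) (lev 8 2).
Proof.
apply: sub_has => p /leq_trans; apply; apply: count_sub_in => R Rs.
have : R \in lev 8 3 by move: Rs; rewrite mem_filter => /andP[].
rewrite mem_lev => /andP[/eqP sR /eqP wR].
rewrite /F /fbits (mask_map (subb^~ R)) all_map => TR.
case/orP: (cover_sublev cx sR wR) => // /hasP[e eR xe].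
by have := allP TR e eR; rewrite /= xe.
Qed.

(** Division by 10 rounds up, hence [181 = 382 - 210 + 9] and, for a tail of at least 28,
    [185 = 386 - 210 + 9]. In the second case a tail of 27 remains, where a star gives
    [15 + 27 = 42], enough for [e + s <= 21]. *)
Definition leaf_ok s G :=
  let e := wt G in let E := excess excess_tab G in
  if 10 * (e + s) <= E + 181 then true
  else if (e + s <= 21) && (10 * (e + s) <= E + 185) then star8 G else false.

Lemma leaf_okP s : leaf_ok s F -> 21 + wt F + s <= b 3 + (b 4 + b 5 + b 6 + b 7 + b 8).
Proof.
rewrite /leaf_ok -/E; have h1 := excess_total; have h2 := excess_total28.
have h41 := upper_ge41 cx; have t27 := tail_ge27 cx.
case: ifP => [h _|_]; first by rewrite /b in h1 *; lia.
case: ifP => // /andP[es h] /star8P/(star_triples cx) h15.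
have [e27|n27] := eqVneq (b 4 + b 5 + b 6 + b 7 + b 8) 27.
  by have := h15 e27; rewrite /b in e27 *; lia.
by rewrite /b in h2 n27 *; lia.
Qed.
End Graph.

(** * Enumeration of graphs *)

(** A state is a subtree of the table with the unread mask of a 6-set; an edge bit descends only if
    the edge lies in the 6-set. Graphs with a common prefix thus share the evaluation of
    [excess]. *)
Definition advance b (st : tree * bitseq) :=
  match st with
  | (Node l r, true :: m) => (if b then r else l, m)
  | (t, m) => (t, behead m)
  end.

Definition value (st : tree * bitseq) := query st.1 [::].

(** Runs through the subsets of [V] that omit at most [r] of its elements; [acc] keeps the bits read
    so far in reverse. *)
Fixpoint dfs (leaf : seq (tree * bitseq) -> bitseq -> bool) V r st acc :=
  match V with
  | [::] => leaf st acc
  | false :: V' => dfs leaf V' r (map (advance false) st) (false :: acc)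
  | true :: V' =>
      if dfs leaf V' r (map (advance true) st) (true :: acc) then
        if r is r'.+1 then dfs leaf V' r' (map (advance false) st) (false :: acc) else true
      else false
  end.

Definition run (st : seq (tree * bitseq)) G := foldl (fun st b => map (advance b) st) st G.

Lemma dfsP leaf V r st acc G : dfs leaf V r st acc -> subb G V -> wt V <= wt G + r ->
  leaf (run st G) (catrev G acc).
Proof.
elim: V G r st acc => [|[] V IH] [|[] G] //= r st acc.
- case: ifP => // h _ GV le; apply: (IH G r _ (true :: acc) h GV).
  by move: le; rewrite /wt /=; lia.
- case: ifP => // _; case: r => [|r] h GV le.
    have : wt G <= wt V; last by move: le; rewrite /wt /= addn0 add1n add0n; lia.
    by elim: G V GV {IH le h} => [|[] G IH] [|[] V] //= /IH; rewrite /wt /=; lia.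
  by apply: (IH G r _ (false :: acc) h GV); move: le; rewrite /wt /=; lia.
- by move=> h GV le; apply: (IH G r _ (false :: acc)).
Qed.

Definition start := [seq (excess_tab, m) | m <- face_masks].
Definition block s m := nseq s true ++ nseq m false.
(** The pairs within the last [m] points come first in [lev (s + m) 2] and are dropped. Of the
    others, those inside the free block are never edges. *)
Definition mixed s m := [seq ~~ subb p (block s m) | p <- drop (size (lev m 2)) (lev (s + m) 2)].

Definition swaps m :=
  [seq [seq if j == i then i.+1 else if j == i.+1 then i else j | j <- iota 0 m] | i <- iota 0 m.-1].

Definition act m q g := [seq nth false g (index (pm q e) (lev m 2)) | e <- lev m 2].

Fixpoint lexlt (g h : bitseq) :=
  match g, h with
  | b :: g', c :: h' => if b then if c then lexlt g' h' else false else if c then true else lexlt g' h'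
  | _, _ => false
  end.

(* Graphs that no adjacent transposition makes lexicographically smaller: for [m <= 5] these are
   few enough, so that full isomorphism classes are not needed. *)
Definition reps m :=
  let L := lev m 2 in
  let acts := [seq [seq index (pm q e) L | e <- L] | q <- swaps m] in
  [seq g <- bits (size L) | ~~ has (fun a => lexlt [seq nth false g i | i <- a] g) acts].

Definition leaf_test s emax st F :=
  let e := wt F in
  if emax < e then true else
  let E := sumn (map value st) in
  if 10 * (e + s) <= E + 181 then true
  else if (e + s <= 21) && (10 * (e + s) <= E + 185) then star8 (rev F) else false.

Definition enum_ok st s m emin emax :=
  let V := mixed s m in let w := wt V in
  all (fun g => let tot := wt g + w in
    if emin <= tot then dfs (leaf_test s emax) V (tot - emin) (run st g) (rev g)
    else true) (reps m).

(* For 3, 4 and 5 free points the linear bound of [excess_edges] leaves these numbers of edges. *)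
Lemma enum_check : let st := start in
  [&& enum_ok st 3 5 18 19, enum_ok st 4 4 17 20 & enum_ok st 5 3 16 18].
Proof. by vm_cast_no_check (erefl true). Qed.

Lemma run_map st G : run st G = [seq foldl (fun u b => advance b u) u G | u <- st].
Proof. by elim: G st => [|b G IH] st /=; rewrite ?map_id // IH -map_comp. Qed.

Lemma run_cat st G1 G2 : run st (G1 ++ G2) = run (run st G1) G2.
Proof. exact: foldl_cat. Qed.

Lemma value_advance n f m G : size G = n -> size m = n ->
  value (foldl (fun u b => advance b u) (build (wt m) f, m) G) = f (mask m G).
Proof.
elim: n f m G => [|n IH] f [|[] m] [|b G] //= [sG] [sm].
  by rewrite (_ : (if b then _ else _) = build (wt m) (f \o cons b)) ?IH //; case: b.
by rewrite -(IH f m G) //; rewrite /wt /= add0n -/(wt m); case: (build _ _).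
Qed.

Lemma run_start F : size F = 28 -> sumn (map value (run start F)) = excess excess_tab F.
Proof.
move=> sF; rewrite run_map /start -2!map_comp /excess; congr sumn; apply/eq_in_map => m mf.
have /andP[/eqP sm /eqP wm] : (size m == 28) && (wt m == 15).
  have /allP : all (fun m => (size m == 28) && (wt m == 15)) face_masks.
    by vm_cast_no_check (erefl true).
  exact.
rewrite /comp.
have -> : excess_tab = build (wt m) (fun F => bound6 F - 8) by rewrite wm.
rewrite (value_advance _ sF sm) query_build //.
by rewrite size_mask ?sF.
Qed.

Lemma subb_pm p s t : subb s t -> subb (pm p s) (pm p t).
Proof.
move=> st; elim: p => //= i p IH; apply/andP; split; last exact: IH.
by apply/implyP; apply: subb_nth.
Qed.

Lemma pm_block s m q u e : size u = s -> perm_eq q (iota 0 m) -> size e = m ->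
  pm (iota 0 s ++ map (addn s) q) (u ++ e) = u ++ pm q e.
Proof.
move=> su pq se; rewrite /pm map_cat -map_comp; congr cat.
  rewrite -[RHS](mkseq_nth false) su; apply/eq_in_map => i; rewrite mem_iota => /= lti.
  by rewrite nth_cat su lti.
by apply: eq_map => i /=; rewrite nth_cat su ltnNge leq_addr addKn.
Qed.

Lemma perm_block s m q : perm_eq q (iota 0 m) ->
  perm_eq (iota 0 s ++ map (addn s) q) (iota 0 (s + m)).
Proof.
move=> pq; rewrite iotaD perm_cat2l -[in iota (0 + s)](addn0 s) add0n iotaDl.
exact: perm_map.
Qed.

Definition free_first s m (x : pred bitseq) :=
  all (fun p => subb p (block s m) ==> x p) (lev (s + m) 2).

Definition tail_graph s m (x : pred bitseq) := [seq ~~ x (nseq s false ++ e) | e <- lev m 2].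

Lemma tail_act s m q x : perm_eq q (iota 0 m) ->
  tail_graph s m (x \o pm (iota 0 s ++ map (addn s) q)) = act m q (tail_graph s m x).
Proof.
move=> pq; apply/eq_in_map => e; rewrite mem_lev => /andP[/eqP se /eqP we].
have eL : pm q e \in lev m 2 by rewrite mem_lev (size_pm _ pq) (wt_pm pq) // we !eqxx.
rewrite (nth_map [::]) ?index_mem // nth_index //=.
by rewrite (pm_block _ pq se) // size_nseq.
Qed.

Lemma free_first_pm s m q x : perm_eq q (iota 0 m) -> free_first s m x ->
  free_first s m (x \o pm (iota 0 s ++ map (addn s) q)).
Proof.
move=> pq /allP fx; apply/allP => p pL; apply/implyP => pb.
have pp := perm_block s pq; move: pL; rewrite mem_lev => /andP[/eqP sp /eqP wp].
have := fx (pm (iota 0 s ++ map (addn s) q) p).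
rewrite mem_lev (size_pm _ pp) (wt_pm pp) // wp !eqxx => /(_ isT)/implyP; apply.
suff -> : block s m = pm (iota 0 s ++ map (addn s) q) (block s m) by apply: subb_pm.
rewrite (pm_block _ pq) ?size_nseq //; congr cat.
apply: (@eq_from_nth _ false) => [|i]; first by rewrite (size_pm _ pq) size_nseq.
rewrite size_nseq => lti; rewrite (nth_map 0) ?(perm_size pq) ?size_iota //.
by rewrite !nth_nseq !if_same.
Qed.

(** The value as a binary numeral, the measure that decreases in [reduce_tail]. *)
Definition bin (s : bitseq) := foldl (fun a (b : bool) => a.*2 + b) 0 s.

Lemma lexlt_bin g h : size g = size h -> lexlt g h -> bin g < bin h.
Proof.
move=> sgh lt; rewrite /bin.
have mono (a b : nat) g' h' : size g' = size h' -> a < b ->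
    foldl (fun a (b : bool) => a.*2 + b) a g' < foldl (fun a (b : bool) => a.*2 + b) b h'.
  by elim: g' h' a b => [|c g' IH] [|d h'] //= a b [s] ab; apply: IH => //; case: c d => [] []; lia.
elim: g h sgh lt 0 => [|[] g IH] [|[] h] //= [s] lt a; first exact: IH.
  by apply: mono => //; lia.
exact: IH.
Qed.

Lemma swaps_perm m q : m <= 5 -> q \in swaps m -> perm_eq q (iota 0 m).
Proof.
move=> m5; have : all (fun m => all (fun q => perm_eq q (iota 0 m)) (swaps m)) (iota 0 6).
  by vm_cast_no_check (erefl true).
by move/allP/(_ m); rewrite mem_iota ltnS m5 => /(_ isT)/allP; apply.
Qed.

(** Descent on [bin]: while some adjacent transposition of the last [m] points makes the tail graph
    smaller, it is applied to the covering. *)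
Lemma reduce_tail s m x : m <= 5 -> cover (s + m) x -> free_first s m x ->
  exists x', [/\ cover (s + m) x', forall k, nlev (s + m) x' k = nlev (s + m) x k,
    free_first s m x' & tail_graph s m x' \in reps m].
Proof.
move=> m5; have [k] := ubnP (bin (tail_graph s m x)).
elim: k x => // k IH x le cx fx.
have [min|] := boolP (tail_graph s m x \in reps m); first by exists x.
rewrite mem_filter mem_bits size_map eqxx andbT negbK => /hasP[a /mapP[q qs ->]].
have pq := swaps_perm m5 qs.
rewrite -map_comp -/(act m q _) -tail_act // => /lexlt_bin lt.
have [|x' [cx' nx' fx' tx']] := IH _ _ (cover_pm (perm_block s pq) cx) (free_first_pm pq fx).
  by apply: leq_trans (lt _) _; rewrite ?size_map.
exists x'; split=> // k'; rewrite nx' (count_pm _ _ (perm_block s pq)) //.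
Qed.

Section Enum.
Variables s m emin emax : nat.
Hypothesis sm : s + m = 8.
Hypothesis m5 : m <= 5.
Hypothesis ok : enum_ok start s m emin emax.
Hypothesis tails : take (size (lev m 2)) (lev 8 2) = [seq nseq s false ++ e | e <- lev m 2].

Lemma enum_leaf x : cover 8 x -> free_first s m x -> tail_graph s m x \in reps m ->
  emin <= wt (fbits 8 x) <= emax -> leaf_ok s (fbits 8 x).
Proof.
move=> cx fx tx /andP[emn emx]; set c := size (lev m 2).
pose G := [seq ~~ x p | p <- drop c (lev 8 2)].
have eF : fbits 8 x = tail_graph s m x ++ G.
  by rewrite /fbits -(cat_take_drop c (lev 8 2)) map_cat tails -map_comp.
have GV : subb G (mixed s m).
  rewrite /mixed /G sm; have : {subset drop c (lev 8 2) <= lev 8 2} by move=> p; apply: mem_drop.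
  elim: (drop c (lev 8 2)) => //= p r IH sub; apply/andP; split; last first.
    by apply: IH => p' p'r; apply: sub; rewrite inE p'r orbT.
  have /(allP fx p)/implyP : p \in lev (s + m) 2 by rewrite sm; apply: sub; apply: mem_head.
  by case: (subb p _) => [-> //|_]; rewrite implybT.
have wF : wt (fbits 8 x) = wt (tail_graph s m x) + wt G by rewrite eF /wt count_cat.
have GVw : wt G <= wt (mixed s m).
  by elim: (G) (mixed s m) GV => [|[] g IH] [|[] v] //= /IH; rewrite /wt /=; lia.
have := allP ok _ tx; cbv beta zeta; rewrite ifT; last by rewrite (leq_trans emn) // wF leq_add2l.
move/dfsP/(_ GV)/(_ _); rewrite catrevE -rev_cat -eF -run_cat -eF /leaf_test revK.
have -> : wt (rev (fbits 8 x)) = wt (fbits 8 x) by rewrite /wt count_rev.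
rewrite ltnNge emx run_start; last by rewrite size_map; vm_compute.
by apply; lia.
Qed.

Definition sorted_free n S :=
  [seq i <- iota 0 n | nth false S i] ++ [seq i <- iota 0 n | ~~ nth false S i].

Lemma pm_sorted_free n S : size S = n -> pm (sorted_free n S) S = block (wt S) (n - wt S).
Proof.
move=> <-; rewrite /pm map_cat /block; congr cat.
  rewrite -[in RHS](mkseq_nth false S) /wt /mkseq count_map.
  elim: (iota 0 (size S)) => //= i r IH; case e : (nth false S i) => //=; rewrite e.
  by rewrite IH.
have -> : size S - wt S = count (predC id) S by rewrite -(count_predC id S) addKn.
rewrite -[in RHS](mkseq_nth false S) /mkseq count_map.
by elim: (iota 0 (size S)) => //= i r IH; case e : (nth false S i) => //=; rewrite e IH.
Qed.

Lemma perm_sorted_free n S : perm_eq (sorted_free n S) (iota 0 n).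
Proof. by rewrite /sorted_free perm_filterC. Qed.

Lemma sort_free x : cover 8 x -> wt (free 8 x) = s ->
  exists x', [/\ cover 8 x', forall k, nlev 8 x' k = nlev 8 x k & free_first s m x'].
Proof.
move=> cx ws; have po := perm_sorted_free 8 (free 8 x).
have pi := perm_inv_perm po.
exists (x \o pm (inv_perm 8 (sorted_free 8 (free 8 x)))); split.
- exact: cover_pm.
- by move=> k; apply: count_pm.
apply/allP => p; rewrite sm => pL; apply/implyP => pb.
have uo : units_ok 8 by vm_cast_no_check (erefl true).
have pp : pm (inv_perm 8 (sorted_free 8 (free 8 x))) p \in lev 8 2.
  move: pL; rewrite !mem_lev => /andP[/eqP sp /eqP wp].
  by rewrite (size_pm _ pi) (wt_pm pi) // wp !eqxx.
apply: (free_pair uo cx pp).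
rewrite -[X in subb _ X](inv_permK po (size_free 8 x)); apply: subb_pm.
by rewrite pm_sorted_free ?size_free // ws -sm addKn.
Qed.

Lemma enum_bound x : cover 8 x -> wt (free 8 x) = s -> emin <= wt (fbits 8 x) <= emax ->
  21 + wt (fbits 8 x) + s <=
    nlev 8 x 3 + (nlev 8 x 4 + nlev 8 x 5 + nlev 8 x 6 + nlev 8 x 7 + nlev 8 x 8).
Proof.
move=> cx ws we; have [x1 [cx1 nx1 fx1]] := sort_free cx ws.
have cx1' : cover (s + m) x1 by rewrite sm.
have [x2 [cx2 nx2 fx2 tx2]] := reduce_tail m5 cx1' fx1; rewrite sm in cx2 nx2.
have nx k : nlev 8 x2 k = nlev 8 x k by rewrite nx2 nx1.
have ew : wt (fbits 8 x2) = wt (fbits 8 x).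
  have w := wt_fbits 8 x; have w2 := wt_fbits 8 x2.
  by apply/eqP; rewrite -(eqn_add2r (nlev 8 x 2)) w -(nx 2) w2.
rewrite -!nx -ew; apply: (leaf_okP cx2).
by apply: (enum_leaf cx2 fx2 tx2); rewrite ew.
Qed.
End Enum.

Lemma free_check : all (fun S => let c := count (fun p => ~~ subb p S) (lev 8 2) in
  if wt S == 5 then c <= 18 else if 5 < wt S then c + wt S <= 20 else true) (bits 8).
Proof. by vm_cast_no_check (erefl true). Qed.

Lemma dbound8 : dbound 8 58.
Proof.
move=> x cx; total 8 x; have b0 := lev0 cx.
have uo : units_ok 8 by vm_cast_no_check (erefl true).
have ws := wt_free x uo; have we := wt_fbits 8 x; have wle := wt_fbits_le uo cx.
have e28 : size (lev 8 2) = 28 by vm_compute.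
rewrite {}e28 in we.
have h41 := upper_ge41 cx; have ht := excess_total cx; have [h15 h45] := excess_edges x.
have inb : free 8 x \in bits 8 by rewrite mem_bits size_free.
have := allP free_check _ inb; cbv beta zeta => fc.
suff : 21 + wt (fbits 8 x) + wt (free 8 x) <=
    nlev 8 x 3 + (nlev 8 x 4 + nlev 8 x 5 + nlev 8 x 6 + nlev 8 x 7 + nlev 8 x 8) by lia.
have [small|big] := leqP (wt (fbits 8 x) + wt (free 8 x)) 20; first by lia.
have /and3P[ok3 ok4 ok5] := enum_check.
have [s5|n5] := eqVneq (wt (free 8 x)) 5.
  rewrite s5 in fc big *.
  have fc' := leq_trans wle fc.
  apply: (enum_bound (s := 5) (m := 3) erefl isT ok5 _ cx s5); last by apply/andP; split; lia.
  by apply/eqP; vm_cast_no_check (erefl true).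
move: fc; rewrite (negbTE n5); case: ifP => s6 fc; first by lia.
have [s4|n4] := eqVneq (wt (free 8 x)) 4.
  have [e21|e20] := ltnP 20 (wt (fbits 8 x)); first by lia.
  rewrite s4 in big *.
  apply: (enum_bound (s := 4) (m := 4) erefl isT ok4 _ cx s4); last by apply/andP; split; lia.
  by apply/eqP; vm_cast_no_check (erefl true).
have [s3|n3] := eqVneq (wt (free 8 x)) 3.
  have [e20|e19] := ltnP 19 (wt (fbits 8 x)); first by lia.
  rewrite s3 in big *.
  apply: (enum_bound (s := 3) (m := 5) erefl isT ok3 _ cx s3); last by apply/andP; split; lia.
  by apply/eqP; vm_cast_no_check (erefl true).
(* At most two uncovered points remain, so [e >= 19], and [excess_edges] with [excess_total]
   suffices. *)
by lia.
Qed.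

(** * The values *)

(** Members are given by their positions in [bits n], that is, as binary numerals with the first
    coordinate most significant. *)
Definition code n ks : seq bitseq := [seq nth [::] (bits n) k | k <- ks].

Lemma value_D n ks : dbound n (size ks) -> is_code n (code n ks) -> is_D n 1 (size ks).
Proof.
move=> lo up; split; last by move=> C; apply: lower_bridge.
by rewrite -(size_map (nth [::] (bits n)) ks); apply: upper_bridge.
Qed.

Theorem theorem1 :
  is_D 1 1 1 /\ is_D 2 1 2 /\ is_D 3 1 3 /\ is_D 4 1 6 /\
  is_D 5 1 10 /\ is_D 6 1 18 /\ is_D 7 1 31 /\ is_D 8 1 58.
Proof.
refine (conj _ (conj _ (conj _ (conj _ (conj _ (conj _ (conj _ _))))))).
- apply: (@value_D 1 [:: 0]) dbound1 _.
  by vm_cast_no_check (erefl true).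
- apply: (@value_D 2 [:: 0; 1]) dbound2 _.
  by vm_cast_no_check (erefl true).
- apply: (@value_D 3 [:: 0; 1; 6]) dbound3 _.
  by vm_cast_no_check (erefl true).
- apply: (@value_D 4 [:: 0; 2; 5; 8; 11; 14]) dbound4 _.
  by vm_cast_no_check (erefl true).
- apply: (@value_D 5 [:: 0; 1; 4; 5; 10; 13; 18; 19; 24; 30]) dbound5 _.
  by vm_cast_no_check (erefl true).
- apply: (@value_D 6 [:: 0; 3; 4; 8; 12; 13; 17; 18; 23; 26; 33; 34; 35; 46; 48; 52; 57; 62]) dbound6 _.
  by vm_cast_no_check (erefl true).
- apply: (@value_D 7 [:: 0; 3; 4; 9; 10; 15; 16; 20; 21; 26; 32; 35; 36; 44; 48; 54; 55; 57;
    65; 66; 70; 72; 73; 83; 92; 94; 101; 106; 109; 112; 123]) (dbound7 dbound6) _.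
  by vm_cast_no_check (erefl true).
- apply: (@value_D 8 [:: 0; 1; 2; 3; 12; 13; 16; 17; 18; 19; 30; 36; 39; 40; 42; 52; 55; 57;
    68; 70; 72; 75; 85; 88; 93; 96; 97; 108; 110; 114; 123; 128; 129; 134; 138; 143; 144; 145;
    147; 156; 162; 165; 168; 170; 182; 183; 185; 194; 196; 198; 201; 215; 218; 227; 237; 240;
    244; 254]) dbound8 _.
  by vm_cast_no_check (erefl true).
Qed.
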